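(* Let $R$ be a simply connected region in the square lattice that admits at least one domino tiling. Then the forcing number of $R$ satisfies $$f(R) \ge \frac{1}{4}\max_{x \in R}\big(h_{\max}(x) - h_{\min}(x)\big),$$ where the maximum is over the lattice points $x$ of $R$.
   Context: A region $R$ in the square lattice is a finite, simply connected union of closed unit squares whose corners lie in $\mathbb{Z}^2$; its points are the lattice points of $R$ (including those on the boundary $\partial R$). A unit square whose lower-left corner is $(a,b)$ is colored white if $a+b \equiv 0 \pmod 2$ and black otherwise. A domino tiling of $R$ is a tiling of $R$ by $1\times 2$ and $2\times 1$ rectangles, each the union of two adjacent unit squares of $R$. A unit grid edge $(x,y)$ belongs to a tiling $T$ if it lies on the boundary of some domino of $T$. The height function of a tiling $T$ is a function $h_T$ from the lattice points of $R$ to $\mathbb{Z}$ such that for every edge $(x,y)$ belonging to $T$ which, when traversed from $x$ to $y$, has a white square on its left, $h_T(x)-h_T(y)=1$; it exists and is unique up to an additive constant. Normalize all height functions to take the value $0$ at a fixed point of $\partial R$; then all height functions agree on $\partial R$. Define $h_{\max}(x)$ and $h_{\min}(x)$ as the maximum and minimum of $h_T(x)$ over all domino tilings $T$ of $R$. A forcing set of a tiling $T$ is a subset of the dominoes of $T$ that is contained in no other domino tiling of $R$; the forcing number $f(T,R)$ is the minimum size of a forcing set of $T$, and the forcing number of $R$ is $f(R)=\min_T f(T,R)$ over all tilings $T$ of $R$. *)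

(* Defs.v *)
From mathcomp Require Import all_boot all_order all_algebra finmap.
From mathcomp Require Import all_classical all_reals all_analysis.
Import Order.TTheory GRing.Theory Num.Theory.
Import numFieldNormedType.Exports.

Set Implicit Arguments.
Unset Strict Implicit.
Unset Printing Implicit Defensive.

Local Open Scope classical_set_scope.
Local Open Scope ring_scope.

(* Greatest and least elements of a set; meaningful only when they exist,
   x0 otherwise. *)
Definition maximum {d : Order.disp_t} {T : porderType d} (x0 : T) (A : set T) : T :=
  xget x0 (A `&` ubound A).

Definition minimum {d : Order.disp_t} {T : porderType d} (x0 : T) (A : set T) : T :=
  xget x0 (A `&` lbound A).

Definition path_in (K : realType) (X : topologicalType) (A : set X) (g : K -> X)
    (x y : X) : Prop :=
  [/\ {within `[0, 1]%classic, continuous g}, g @` `[0, 1]%classic `<=` A, g 0 = x & g 1 = y].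

Definition path_connected (K : realType) (X : topologicalType) (A : set X) : Prop :=
  A !=set0 /\ forall x y, A x -> A y -> exists g : K -> X, path_in A g x y.

(* H (t, s) is the loop at time s; the base point stays fixed throughout. *)
Definition null_homotopic_in (K : realType) (X : topologicalType) (A : set X)
    (g : K -> X) (x : X) : Prop :=
  exists H : K * K -> X,
    [/\ {within `[0, 1]%classic `*` `[0, 1]%classic, continuous H},
        H @` (`[0, 1]%classic `*` `[0, 1]%classic) `<=` A,
        (forall t, t \in `[0, 1] -> H (t, 0) = g t /\ H (t, 1) = x) &
        (forall s, s \in `[0, 1] -> H (0, s) = x /\ H (1, s) = x)].

Definition simply_connected (K : realType) (X : topologicalType) (A : set X) : Prop :=
  path_connected K A /\
  forall (x : X) (g : K -> X), path_in A g x x -> null_homotopic_in A g x.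

Definition vertex := (int * int)%type.

(* A unit square is named by its lower-left corner. *)
Definition cell := (int * int)%type.

Definition closed_square (K : realType) (c : cell) : set (K * K) :=
  `[c.1%:~R, (c.1 + 1)%:~R]%classic `*`
  `[c.2%:~R, (c.2 + 1)%:~R]%classic.
Arguments closed_square : clear implicits.

(* A finite set of cells S stands for the union of its closed squares, and is
   determined by it. *)
Definition carrier (K : realType) (S : {fset cell}) : set (K * K) :=
  \bigcup_(c in [set` S]) closed_square K c.
Arguments carrier : clear implicits.

Definition region (K : realType) (S : {fset cell}) : Prop :=
  simply_connected K (carrier K S).

Definition embed (K : realType) (x : vertex) : K * K := (x.1%:~R, x.2%:~R).

Definition lattice_points (K : realType) (S : {fset cell}) : set vertex :=
  [set x | carrier K S (embed K x)].

Definition boundary_points (K : realType) (S : {fset cell}) : set vertex :=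
  [set x | (closure (carrier K S) `\` (carrier K S)°) (embed K x)].

Definition white (c : cell) : bool := (2 %| c.1 + c.2)%Z.

Definition is_domino (d : {fset cell}) : Prop :=
  exists a b : int,
    d = [fset (a, b); ((a + 1)%R, b)]%fset \/ d = [fset (a, b); (a, (b + 1)%R)]%fset.

Definition is_tiling (S : {fset cell}) (T : {fset {fset cell}}) : Prop :=
  (forall d, d \in T -> is_domino d /\ (d `<=` S)%fset) /\
  (forall c, c \in S -> exists! d, d \in T /\ c \in d).

(* grid_edge x y l r: (x, y) is a unit grid edge and, going from x to y, the
   unit square on its left is l and the one on its right is r. *)
Inductive grid_edge : vertex -> vertex -> cell -> cell -> Prop :=
| East a b : grid_edge (a, b) (a + 1, b) (a, b) (a, b - 1)
| North a b : grid_edge (a, b) (a, b + 1) (a - 1, b) (a, b)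
| West a b : grid_edge (a + 1, b) (a, b) (a, b - 1) (a, b)
| South a b : grid_edge (a, b + 1) (a, b) (a, b) (a - 1, b).

(* A unit edge lies on the boundary of a union of cells exactly when one of its
   two sides is in the union and the other is not. *)
Definition edge_in_tiling (T : {fset {fset cell}}) (l r : cell) : Prop :=
  exists2 d, d \in T & (l \in d) (+) (r \in d).

(* The left square l need not belong to the tiled region: the whole plane is
   coloured.  The values of h away from the lattice points of the region are
   unconstrained. *)
Definition is_height (T : {fset {fset cell}}) (h : vertex -> int) : Prop :=
  forall x y l r, grid_edge x y l r -> edge_in_tiling T l r -> white l ->
    h x - h y = 1.

(* The height function of T vanishing at p; for a tiling T of a region it is
   unique on the lattice points of the region. *)
Definition height (T : {fset {fset cell}}) (p : vertex) : vertex -> int :=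
  xget (fun=> 0) [set h | is_height T h /\ h p = 0].

Definition hmax (S : {fset cell}) (p x : vertex) : int :=
  maximum 0 [set height T p x | T in is_tiling S].

Definition hmin (S : {fset cell}) (p x : vertex) : int :=
  minimum 0 [set height T p x | T in is_tiling S].

Definition forcing_set (S : {fset cell}) (T F : {fset {fset cell}}) : Prop :=
  (F `<=` T)%fset /\
  forall T', is_tiling S T' -> (F `<=` T')%fset -> T' = T.

Definition forcing_number_of (S : {fset cell}) (T : {fset {fset cell}}) : nat :=
  minimum 0%N [set #|` F|%fset | F in forcing_set S T].

Definition forcing_number (S : {fset cell}) : nat :=
  minimum 0%N [set forcing_number_of S T | T in is_tiling S].

(* Main.v *)
(* Let F be a minimum forcing set of a tiling T, and let h1, h2 be heights of two
   tilings with h1 x - h2 x = 4M > 0.  Since R is simply connected, h1 and h2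
   exist and agree on its boundary, and (h1 - h2)/4 changes by at most 1
   between two corners of a cell; hence the 2M x 2M square Q of cells centred at
   x lies in R.  The median of h2, h1 and a height function that is flat on the
   border of Q is again a height function, so the cells outside Q can be matched
   without crossing the border of Q.

   As F is forcing, the white cells can be ordered so that every initial segment
   W satisfies |N(W)| <= |W| + |F|.  Cut Q into M horizontal and M vertical
   strips of width 2.  Just before the first strip is exhausted by W, every strip
   of the other direction meets W without being contained in it; each such
   strip contains a cell of N(W) whose mate, in a matching that respects these
   strips and Q, lies outside W.  Hence |N(W)| >= |W| + M, and so M <= |F|. *)
Require Import Defs.
From mathcomp Require Import all_boot all_order all_algebra finmap.
From mathcomp Require Import all_classical all_reals all_analysis.
From mathcomp Require Import zify ring lra.
Import Order.TTheory GRing.Theory Num.Theory.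
Import numFieldNormedType.Exports.
Set Implicit Arguments.
Unset Strict Implicit.
Unset Printing Implicit Defensive.
Local Open Scope classical_set_scope.
Local Open Scope ring_scope.

(** * Connectedness and exactness on simply connected regions *)

(** A region may be pinched at corners: its interior can be disconnected and its boundary need not
    be a simple closed curve. So nothing is proved by walking along the boundary. Simple
    connectivity enters combinatorially, through the fact that a cocycle on pairs of cells sharing a
    corner is a coboundary; heights exist by this. For agreement on the boundary, [(h1 - h2) / 4] is
    compared with a potential, on the whole plane, of the flow formed by the dominoes of both
    tilings. This flow has finite support, and rays show that its potential vanishes off the region.

    The tiling forced by [F] is unrelated to the two tilings that realise the gap: it supplies only
    the ordering of the white cells, while the gap supplies the square and the matching outside it.
    The constants fit because a height changes by exactly 2 along a diagonal of a cell: a gap of 4M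
    leaves room for the middle level [h1 x - 2M] at Chebyshev distance M, and a square of side 2M
    has M strips of width 2 in either direction. *)

Lemma within_compact_unif (K : realType) (X Y : pseudoMetricType K) (A : set X)
    (f : X -> Y) (e : K) :
  compact A -> {within A, continuous f} -> 0 < e ->
  exists N0 : nat, forall N x y, (N0 <= N)%N -> A x -> A y ->
    ball x N.+1%:R^-1 y -> ball (f x) e (f y).
Proof.
move=> cA /subspace_continuousP cf e0.
have e20 : 0 < e / 2 by rewrite divr_gt0.
have := (iffLR (compact_near_coveringP A)) cA nat \oo
  (fun N x => A x -> forall y, A y -> ball x N.+1%:R^-1 y -> ball (f x) e (f y)) _.
case.
- move=> x Ax.
  have /nbhs_ballP [d /= d0 hd] : nbhs x (fun y => A y -> ball (f x) (e / 2) (f y)).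
    by have := cf x Ax _ (nbhsx_ballx (f x) (e / 2) e20).
  exists (ball x (d / 2), [set N : nat | N.+1%:R^-1 < d / 2]).
    split; first by apply: nbhsx_ballx; rewrite divr_gt0.
    exact: near_infty_natSinv_lt (PosNum (divr_gt0 d0 (ltr0Sn _ 1))).
  move=> [x' N] /= [xx' Nd] Ax' y Ay x'y.
  apply: (@ball_splitr _ _ (f x)).
    apply: (hd x') Ax'; apply: le_ball xx'.
    by lra.
  apply: (hd y) Ay; rewrite [d]splitr.
  apply: ball_triangle xx' _; apply: le_ball x'y; exact: ltW.
- move=> N0 _ H; exists N0 => N x y N0N Ax Ay; exact: H.
Qed.

(** The closed squares meet, possibly in a single corner. Diagonal neighbours count because a region
    may be connected only through a corner. *)
Definition near_cells (c c' : cell) : bool :=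
  (`|c.1 - c'.1| <= 1) && (`|c.2 - c'.2| <= 1).

Lemma near_cells_refl c : near_cells c c.
Proof. by rewrite /near_cells !subrr !normr0. Qed.

Lemma closed_squareE (K : realType) (c : cell) (a : K * K) :
  closed_square K c a <->
  (c.1%:~R <= a.1 <= c.1%:~R + 1) /\ (c.2%:~R <= a.2 <= c.2%:~R + 1).
Proof. by rewrite /closed_square /= !in_itv /= !intrD. Qed.

Lemma near_intervals (K : realType) (i j : int) (s t : K) :
  i%:~R <= s <= i%:~R + 1 -> j%:~R <= t <= j%:~R + 1 -> `|s - t| < 1 ->
  `|i - j| <= 1.
Proof.
rewrite ltr_norml => /andP[h1 h2] /andP[h3 h4] /andP[h5 h6].
have hij : (i%:~R : K) < (j + 2)%:~R by rewrite intrD; lra.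
have hji : (j%:~R : K) < (i + 2)%:~R by rewrite intrD; lra.
by move: hij hji; rewrite !ltr_int; lia.
Qed.

Lemma near_cells_ball (K : realType) c c' (a b : K * K) :
  closed_square K c a -> closed_square K c' b -> ball a 1 b -> near_cells c c'.
Proof.
move=> /closed_squareE[a1 a2] /closed_squareE[b1 b2] [/= ab1 ab2].
by apply/andP; split;
  [apply: near_intervals a1 b1 ab1|apply: near_intervals a2 b2 ab2].
Qed.

Lemma near_fin (K : realType) (N k l : nat) :
  (k <= l.+1)%N -> (l <= k.+1)%N ->
  `|k%:R / N.+1%:R - l%:R / N.+1%:R| < (N.+1%:R / 2)^-1 :> K.
Proof.
move=> kl lk; rewrite -mulrBl normrM [X in _ * X]ger0_norm ?invr_ge0 ?ler0n//.
rewrite invfM invrK mulrC ltr_pM2l ?invr_gt0 ?ltr0n// ltr_norml.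
move: kl lk; rewrite -!(ler_nat K) !mulrSr; lra.
Qed.

Lemma corner_in_square (K : realType) (c : cell) :
  closed_square K c (c.1%:~R, c.2%:~R).
Proof. by apply/closed_squareE; split => /=; lra. Qed.

(* A path sampled finely enough visits cells that are consecutively near. *)
Lemma region_connected (K : realType) (S : {fset cell}) (P : cell -> Prop) :
  region K S ->
  (forall c c', c \in S -> c' \in S -> near_cells c c' -> P c -> P c') ->
  forall c c', c \in S -> c' \in S -> P c -> P c'.
Proof.
move=> [[_ pc] _] hP c c' cS c'S Pc.
have Sc d : d \in S -> carrier K S (d.1%:~R, d.2%:~R).
  by move=> dS; exists d => //; exact: corner_in_square.
have [g [cg gA g0 g1]] := pc _ _ (Sc c cS) (Sc c' c'S).
have [N0 hN] := within_compact_unif (@segment_compact K 0 1) cg ltr01.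
pose N := N0.*2.+1.
have gk k : (k <= N.+1)%N -> `[0, 1]%classic (k%:R / N.+1%:R : K).
  move=> kN; rewrite /= in_itv /= divr_ge0 ?ler0n//= ler_pdivrMr ?ltr0n// mul1r.
  by rewrite ler_nat.
have near_in x y : closed_square K x y -> x \in S -> forall z, z \in S ->
    closed_square K z y -> P x -> P z.
  move=> xy xS z zS zy; apply: hP => //.
  by apply: near_cells_ball xy zy _; exact: ballxx.
suff H k : (k <= N.+1)%N -> forall d, d \in S ->
    closed_square K d (g (k%:R / N.+1%:R)) -> P d.
  apply: (H N.+1) => //; rewrite divff ?pnatr_eq0// g1.
  exact: corner_in_square.
elim: k => [_|k IH kN] d dS.
  rewrite mul0r g0 => dc; exact: near_in (corner_in_square K c) cS d dS dc Pc.
move=> dg; have kN' := ltnW kN.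
have gd : carrier K S (g (k%:R / N.+1%:R)) by apply: gA; exists (k%:R / N.+1%:R) => //; exact: gk.
have [d' /= d'S d'g] := gd.
have := IH kN' d' d'S d'g; apply: hP => //.
apply: near_cells_ball d'g dg _.
apply: (hN N0 _ _ (leqnn _) (gk k kN') (gk k.+1 kN)).
have kk : (k <= k.+2)%N by rewrite ltnW.
have h := @near_fin K N k k.+1 kk (leqnn _).
rewrite /ball /=; apply: lt_le_trans h _.
by rewrite /N -doubleS -muln2 natrM mulfK ?pnatr_eq0.
Qed.

(** * Polygonal paths *)

Section Polyline.
Variable K : realType.
Implicit Types (u : nat -> K) (y : K) (n j : nat).

Definition clamp y : K := Num.min 1 (Num.max 0 y).

(** Linear interpolation of [u] on [[0, n]], constant outside. As a sum of clamped ramps it is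
    continuous without any gluing of pieces. *)
Definition polyline u n y : K :=
  u 0%N + \sum_(i < n) clamp (y - i%:R) * (u i.+1 - u i).

Lemma polylineS u n y :
  polyline u n.+1 y = polyline u n y + clamp (y - n%:R) * (u n.+1 - u n).
Proof. by rewrite /polyline big_ord_recr /= addrA. Qed.

Lemma polyline_right u n y : n%:R <= y -> polyline u n y = u n.
Proof.
elim: n => [|n IH] ny; first by rewrite /polyline big_ord0 addr0.
move: ny; rewrite mulrSr => ny; rewrite polylineS IH; last by lra.
suff -> : clamp (y - n%:R) = 1 by ring.
by rewrite /clamp (elimT max_idPr) ?(elimT min_idPl); lra.
Qed.

Lemma polyline_left u n j y : (j <= n)%N -> y <= j%:R ->
  polyline u n y = polyline u j y.
Proof.
elim: n => [|n IH]; first by rewrite leqn0 => /eqP->.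
rewrite leq_eqVlt => /orP[/eqP->//|jn yj].
rewrite polylineS IH//; suff -> : clamp (y - n%:R) = 0 by ring.
have jn' : j%:R <= n%:R :> K by rewrite ler_nat.
by rewrite /clamp (elimT max_idPl) ?(elimT min_idPr); lra.
Qed.

(** Half a unit is half the side of a square: a path through cell centres, with coordinate
    increments at most 1, stays in the closed square of the nearest index. *)
Lemma polyline_near u n j y :
  (forall i, (i < n)%N -> `|u i.+1 - u i| <= 1) -> (j <= n)%N ->
  `|y - j%:R| <= 1 / 2 -> `|polyline u n y - u j| <= 1 / 2.
Proof.
move=> u1 jn; rewrite ler_norml => /andP[y1 y2].
have clampE t : 0 <= t -> t <= 1 -> clamp t = t.
  by move=> t0 t1; rewrite /clamp (elimT max_idPr) ?(elimT min_idPr).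
have small (c w : K) : `|c| <= 1 / 2 -> `|w| <= 1 -> `|c * w| <= 1 / 2.
  by move=> hc hw; rewrite normrM -[leRHS]mulr1 ler_pM.
have [yj|/ltW jy] := leP y j%:R.
- rewrite (polyline_left _ jn)//; case: j jn y1 y2 yj => [|j] jn y1 y2 yj.
    by rewrite /polyline big_ord0 addr0 subrr normr0; lra.
  move: y1 y2 yj; rewrite (mulrSr 1 j) => y1 y2 yj.
  rewrite polylineS polyline_right; last by lra.
  rewrite clampE; [|lra|lra].
  rewrite [X in `|X|](_ : _ = (y - (j%:R + 1)) * (u j.+1 - u j)); last by ring.
  by apply: small; [rewrite ler_norml; lra|exact: u1].
- move: jn; rewrite leq_eqVlt => /orP[/eqP jn|jn].
    by rewrite -jn polyline_right// subrr normr0; lra.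
  have yj1 : y <= j.+1%:R by rewrite (mulrSr 1 j); lra.
  rewrite (polyline_left _ jn yj1).
  rewrite polylineS polyline_right; last by lra.
  rewrite clampE; [|lra|lra].
  rewrite addrAC subrr add0r; apply: small; last exact: u1.
  by rewrite ler_norml; lra.
Qed.

Lemma continuous_polyline u n (a : K) : continuous (fun t => polyline u n (a * t)).
Proof.
have cclamp b : continuous (fun t : K => clamp (a * t - b)).
  move=> t; apply: (@continuous_min _ _ (fun=> 1) (fun s => Num.max 0 (a * s - b))); first exact: cvg_cst.
  apply: (@continuous_max _ _ (fun=> 0) (fun s => a * s - b)); first exact: cvg_cst.
  apply: cvgB; last exact: cvg_cst.
  by apply: cvgM; [exact: cvg_cst|exact: cvg_id].
move=> t; apply: cvgD; first exact: cvg_cst.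
elim: n => [|n IH].
  rewrite (_ : (fun _ => _) = fun=> 0); first by rewrite big_ord0; exact: cvg_cst.
  by apply/funext => s; rewrite big_ord0.
rewrite (_ : (fun _ => _) = fun s => \sum_(i < n) clamp (a * s - i%:R) * (u i.+1 - u i)
   + clamp (a * s - n%:R) * (u n.+1 - u n)); last first.
  by apply/funext => s; rewrite big_ord_recr.
rewrite big_ord_recr; apply: cvgD => //.
by apply: cvgM; [exact: cclamp|exact: cvg_cst].
Qed.

End Polyline.

(** * Cech 1-cocycles for the cover of the region by its closed squares *)

Definition nerve_cocycle (S : {fset cell}) (J : cell -> cell -> int) : Prop :=
  forall a b c, a \in S -> b \in S -> c \in S ->
    near_cells a b -> near_cells b c -> near_cells a c ->
    J a b + J b c = J a c.

(** Resampling a sequence of cells more finely only adds pauses, and a pause contributes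
    [J c c = 0]. *)
Lemma sum_monotone_steps (J : cell -> cell -> int) (f : nat -> cell) (q : nat -> nat) N :
  q 0%N = 0%N -> (forall k, (q k <= q k.+1 <= (q k).+1)%N) ->
  (forall k, (k <= N)%N -> J (f (q k)) (f (q k)) = 0) ->
  \sum_(k < N) J (f (q k)) (f (q k.+1)) = \sum_(j < q N) J (f j) (f j.+1).
Proof.
move=> q0 qS J0; elim: N J0 => [|N IH] J0; first by rewrite q0 !big_ord0.
rewrite big_ord_recr /= IH => [|k kN]; last by apply: J0; exact: leqW.
have /andP[] := qS N; rewrite leq_eqVlt => /orP[/eqP<- _|q1 q2].
  by rewrite J0 ?addr0.
have -> : q N.+1 = (q N).+1 by apply/eqP; rewrite eqn_leq q1 q2.
by rewrite big_ord_recr.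
Qed.

(** Discrete homotopy invariance: consecutive rows have equal sums, and the top row is constant. *)
Lemma grid_sum (J : cell -> cell -> int) (S : {fset cell}) (d : nat -> nat -> cell)
    (N : nat) (c0 : cell) :
  nerve_cocycle S J ->
  (forall k l, (k <= N)%N -> (l <= N)%N -> d k l \in S) ->
  (forall k l k' l', (k <= N)%N -> (l <= N)%N -> (k' <= N)%N -> (l' <= N)%N ->
     (k <= k'.+1)%N -> (k' <= k.+1)%N -> (l <= l'.+1)%N -> (l' <= l.+1)%N ->
     near_cells (d k l) (d k' l')) ->
  (forall l, (l <= N)%N -> d 0%N l = c0 /\ d N l = c0) ->
  (forall k, (k <= N)%N -> d k N = c0) ->
  \sum_(k < N) J (d k 0%N) (d k.+1 0%N) = 0.
Proof.
move=> hJ dS dn dside dtop.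
have J0 c : c \in S -> J c c = 0.
  by move=> cS; have := hJ c c c cS cS cS; rewrite near_cells_refl => /(_ isT isT isT); lia.
have row l : (l <= N)%N -> \sum_(k < N) J (d k l) (d k.+1 l) = \sum_(k < N) J (d k 0%N) (d k.+1 0%N).
  elim: l => // l IH lN; rewrite -IH; last exact: ltnW.
  have lN' := ltnW lN.
  (* Climb the ladder between rows l and l + 1. A diagonal cuts each square into two cocycle
     relations; the vertical terms at both ends vanish because the sides of the grid are
     constant. *)
  suff H n : (n <= N)%N ->
     \sum_(k < n) J (d k l.+1) (d k.+1 l.+1) + J (d 0%N l) (d 0%N l.+1) =
     \sum_(k < n) J (d k l) (d k.+1 l) + J (d n l) (d n l.+1).
    have [e1 e2] := dside _ lN; have [e3 e4] := dside _ lN'.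
    have := H N (leqnn _); rewrite e1 e2 e3 e4 J0 ?addr0//.
    by rewrite -e3; exact: dS.
  elim: n => [|n IHn] nN; first by rewrite !big_ord0.
  rewrite !big_ord_recr /= addrAC IHn; last exact: ltnW.
  have nN' := ltnW nN.
  have h1 : J (d n l) (d n l.+1) + J (d n l.+1) (d n.+1 l.+1) = J (d n l) (d n.+1 l.+1).
    by apply: hJ; (apply: dS || apply: dn); lia.
  have h2 : J (d n l) (d n.+1 l) + J (d n.+1 l) (d n.+1 l.+1) = J (d n l) (d n.+1 l.+1).
    by apply: hJ; (apply: dS || apply: dn); lia.
  by rewrite -!addrA h1 h2.
rewrite -(row N (leqnn _)) big1// => k _.
rewrite !dtop ?J0//; [|exact: ltnW].
by rewrite -(dtop N)// dS.
Qed.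

(** The integer nearest to [k / m], halves rounded up. *)
Definition round_div (m k : nat) : nat := (k.*2 + m) %/ m.*2.

Lemma round_div_bounds m k : (0 < m)%N ->
  (round_div m k * m.*2 <= k.*2 + m < (round_div m k).+1 * m.*2)%N.
Proof. by move=> m0; rewrite leq_divM ltn_ceil// double_gt0. Qed.

Lemma round_divM m n : (0 < m)%N -> round_div m (n * m) = n.
Proof.
move=> m0; rewrite /round_div doubleMr divnMDl ?double_gt0// divn_small ?addn0//.
by lia.
Qed.

Lemma round_divS m k : (0 < m)%N ->
  (round_div m k <= round_div m k.+1 <= (round_div m k).+1)%N.
Proof.
move=> m0; have /andP[_ h] := round_div_bounds k m0.
apply/andP; split; first by apply: leq_div2r; lia.
by rewrite -ltnS ltn_divLR ?double_gt0// mulSn; lia.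
Qed.

Lemma round_div_dist (K : realFieldType) m k : (0 < m)%N ->
  `|k%:R / m%:R - (round_div m k)%:R| <= 1 / 2 :> K.
Proof.
move=> m0; have /andP[] := round_div_bounds k m0; set q := round_div m k.
have mK : 0 < m%:R :> K by rewrite ltr0n.
rewrite -[q.+1]addn1 -(ler_nat K) -(ltr_nat K) -!muln2 !(natrD, natrM) => h1 h2.
rewrite (_ : _ - _ = (k%:R * 2%:R - q%:R * (m%:R * 2%:R)) / (m%:R * 2%:R)); last first.
  by field; rewrite gt_eqF.
have h : 0 < m%:R * 2%:R :> K by rewrite mulr_gt0.
rewrite normrM normfV (ger0_norm (ltW h)) ler_pdivrMr//.
by rewrite ler_norml; apply/andP; split; lra.
Qed.

Section Loop.
Variables (K : realType) (f : nat -> cell) (n : nat).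
Hypothesis f_near : forall i, (i < n)%N -> near_cells (f i) (f i.+1).

Definition center (c : cell) : K * K := (c.1%:~R + 1 / 2, c.2%:~R + 1 / 2).

Definition cell_path (y : K) : K * K :=
  (polyline (fun i => (center (f i)).1) n y, polyline (fun i => (center (f i)).2) n y).

Lemma cell_path_near y j : (j <= n)%N -> `|y - j%:R| <= 1 / 2 ->
  closed_square K (f j) (cell_path y).
Proof.
move=> jn yj.
have step (i : nat) (s t : int) : `|s - t| <= 1 ->
    `|(t%:~R + 1 / 2) - (s%:~R + 1 / 2)| <= 1 :> K.
  move=> st; rewrite (_ : _ - _ = (t - s)%:~R); last by rewrite intrB; ring.
  by rewrite -intr_norm -[leRHS]/(1%:~R) ler_int distrC.
apply/closed_squareE; split.
  have /ler_normlP := polyline_near (u := fun i => (center (f i)).1)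
    (fun i ni => step i _ _ (proj1 (andP (f_near ni)))) jn yj.
  by rewrite /cell_path /= => -[h1 h2]; lra.
have /ler_normlP := polyline_near (u := fun i => (center (f i)).2)
  (fun i ni => step i _ _ (proj2 (andP (f_near ni)))) jn yj.
by rewrite /cell_path /= => -[h1 h2]; lra.
Qed.

Lemma cell_path0 : cell_path 0 = center (f 0%N).
Proof. by rewrite /cell_path !(@polyline_left _ _ _ 0)// /polyline !big_ord0 !addr0. Qed.

Lemma cell_pathn : cell_path n%:R = center (f n).
Proof. by rewrite /cell_path !polyline_right. Qed.

End Loop.

(* Sample a null homotopy on a fine grid: the cells chosen at the corners of a
   grid square are pairwise near, so J sums to 0 around that square. *)
Lemma region_loop (K : realType) (S : {fset cell}) (J : cell -> cell -> int)
    (f : nat -> cell) (n : nat) :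
  region K S -> nerve_cocycle S J ->
  (forall i, (i <= n)%N -> f i \in S) ->
  (forall i, (i < n)%N -> near_cells (f i) (f i.+1)) -> f n = f 0%N ->
  \sum_(i < n) J (f i) (f i.+1) = 0.
Proof.
move=> [_ sc] hJ fS fn fn0.
case: (posnP n) => [->|n0]; first by rewrite big_ord0.
pose g (t : K) := cell_path f n (n%:R * t).
have half_near (y : K) : 0 <= y -> y <= n%:R ->
    exists2 j, (j <= n)%N & `|y - j%:R| <= 1 / 2.
  move=> y0 yn; have := truncn_itv y0; set j := Num.truncn y => /andP[jy yj].
  have yj1 : y < j%:R + 1 by rewrite (mulrSr 1 j) in yj.
  have jn : (j <= n)%N by rewrite -(ler_nat K); lra.
  have [h|h] := leP (y - j%:R) (1 / 2).
    by exists j => //; rewrite ler_norml; lra.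
  exists j.+1; last by rewrite (mulrSr 1 j) ler_norml; lra.
  rewrite ltn_neqAle jn andbT; apply/eqP => jn'; move: yn; rewrite -jn'; lra.
have gA : g @` `[0, 1]%classic `<=` carrier K S.
  move=> _ [t /= + <-]; rewrite in_itv /= => /andP[t0 t1].
  have nt0 : 0 <= n%:R * t by rewrite mulr_ge0.
  have [j jn hj] := half_near _ nt0 (ler_piMr (ler0n _ _) t1).
  by exists (f j); [exact: fS|exact: cell_path_near].
have gp : path_in (carrier K S) g (center K (f 0%N)) (center K (f 0%N)).
  split => //.
  - apply: continuous_subspaceT.
    move=> t; have c1 := @continuous_polyline K (fun i => (center K (f i)).1) n n%:R t.
    have c2 := @continuous_polyline K (fun i => (center K (f i)).2) n n%:R t.
    exact: (cvg_pair c1 c2).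
  - by rewrite /g mulr0 cell_path0.
  - by rewrite /g mulr1 cell_pathn fn0.
have [H [cH HA Hbot Hside]] := sc _ _ gp.
have cI : compact (`[0, 1]%classic `*` `[0, 1]%classic : set (K * K)).
  by apply: compact_setX; exact: segment_compact.
have [N0 hN] := within_compact_unif cI cH ltr01.
(* Each step of the loop is cut into [m] parts; the factor 2 makes the mesh [1 / N] at most half of
   the radius [1 / (N0 + 1)]. *)
pose m := (N0.+1).*2.
pose N := (n * m)%N.
have N_gt0 : (0 < N)%N by rewrite muln_gt0 n0.
have N0N : (N0.+1.*2 <= N)%N by rewrite leq_pmull.
have NS : N.-1.+1 = N by rewrite prednK.
pose tt (k : nat) : K := k%:R / N%:R.
have ttI k : (k <= N)%N -> tt k \in `[0, 1].
  move=> kN; rewrite in_itv /= divr_ge0 ?ler0n//= ler_pdivrMr ?ltr0n// mul1r.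
  by rewrite ler_nat.
pose q := round_div m.
have m0 : (0 < m)%N by [].
have q0 : q 0%N = 0%N by rewrite -(mul0n m) /q round_divM.
have qN : q N = n by exact: round_divM.
have qS k : (q k <= q k.+1 <= (q k).+1)%N by exact: round_divS.
have qn k : (k <= N)%N -> (q k <= n)%N.
  by move=> kN; rewrite -qN /q; apply: leq_div2r; rewrite leq_add2r leq_double.
have qg k : (k <= N)%N -> closed_square K (f (q k)) (g (tt k)).
  move=> kN; apply: cell_path_near => //; first exact: qn.
  rewrite (_ : n%:R * tt k = k%:R / m%:R); first exact: round_div_dist.
  rewrite /tt /N natrM; field; rewrite !pnatr_eq0 -!lt0n; exact/andP.
(* The cell chosen at a grid point is prescribed on the sides of the grid: [f (q k)] on the bottom,
   [f 0] on the other three. The prescriptions agree at the bottom corners since [q 0 = 0],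
   [q N = n] and [f n = f 0]. *)
pose good (kl : nat * nat) c := (kl.1 <= N)%N -> (kl.2 <= N)%N ->
   [/\ c \in S, closed_square K c (H (tt kl.1, tt kl.2)),
     kl.2 = 0%N -> c = f (q kl.1) &
     (kl.1 == 0%N) || (kl.1 == N) || (kl.2 == N) -> c = f 0%N].
have [d hd] : {d & forall kl, good kl (d kl)}.
  apply: choice => -[k l]; rewrite /good /=.
  have tt0 : tt 0%N = 0 by rewrite /tt mul0r.
  have ttN : tt N = 1 by rewrite /tt divff// pnatr_eq0 -lt0n.
  have fc c : closed_square K c (center K c).
    by apply/closed_squareE; split => /=; lra.
  case: (boolP ((k == 0%N) || (k == N) || (l == N))) => [hkl|hkl].
    exists (f 0%N) => kN lN; split=> //; first exact: fS.
    - suff -> : H (tt k, tt l) = center K (f 0%N) by exact: fc.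
      case/orP: hkl => [/orP[]|] /eqP ->; rewrite ?tt0 ?ttN.
      + by have [] := Hside _ (ttI _ lN).
      + by have [] := Hside _ (ttI _ lN).
      + by have [] := Hbot _ (ttI _ kN).
    - move=> l0; case/orP: hkl => [/orP[]|] /eqP e; rewrite ?e ?q0 ?qN ?fn0//.
      by move: N_gt0; rewrite -e l0.
  case: (posnP l) hkl => [->|l0] hkl.
    exists (f (q k)) => kN lN; split=> //.
    - by apply: fS; exact: qn.
    - by have [] := Hbot _ (ttI _ kN); rewrite tt0 => -> _; exact: qg.
  case: (leqP k N) => kN; last by exists (f 0%N).
  case: (leqP l N) => lN; last by exists (f 0%N).
  have Hkl : carrier K S (H (tt k, tt l)).
    by apply: HA; exists (tt k, tt l) => //; split; exact: ttI.
  case: Hkl => c cS Hc; exists c => _ _; split => //.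
  by move=> l0'; move: l0; rewrite l0'.
transitivity (\sum_(k < N) J (f (q k)) (f (q k.+1))).
  rewrite (@sum_monotone_steps J f q N) ?qN// => k kN.
  have cS := fS _ (qn _ kN); have := hJ _ _ _ cS cS cS.
  by rewrite near_cells_refl => /(_ isT isT isT); lia.
transitivity (\sum_(k < N) J (d (k : nat, 0%N)) (d (k.+1, 0%N))).
  apply: eq_bigr => k _.
  have [_ _ -> // _] := hd (k : nat, 0%N) (ltnW (ltn_ord k)) (leq0n _).
  by have [_ _ -> // _] := hd (k.+1, 0%N) (ltn_ord k) (leq0n _).
apply: (@grid_sum J S (fun k l => d (k, l)) N (f 0%N)) => //.
- by move=> k l kN lN; case: (hd (k, l) kN lN).
- move=> k l k' l' kN lN kN' lN' kk' k'k ll' l'l.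
  have [_ h1 _ _] := hd (k, l) kN lN; have [_ h2 _ _] := hd (k', l') kN' lN'.
  apply: near_cells_ball h1 h2 _; apply: (hN N0) => //.
  + by split; exact: ttI.
  + by split; exact: ttI.
  + have aux a b : (a <= b.+1)%N -> (b <= a.+1)%N -> `|tt a - tt b| < N0.+1%:R^-1.
      move=> ab ba; have := @near_fin K N.-1 a b ab ba; rewrite NS => /lt_le_trans; apply.
      rewrite lef_pV2 ?posrE ?divr_gt0 ?ltr0n// ler_pdivlMr// -natrM ler_nat muln2.
      exact: N0N.
    by split; exact: aux.
- by move=> l lN; split; [have [_ _ _ ->] := hd (0%N, l) (leq0n _) lN|
     have [_ _ _ ->] := hd (N, l) (leqnn _) lN]; rewrite /= ?eqxx ?orbT.
- by move=> k kN; have [_ _ _ ->] := hd (k, N) kN (leqnn _); rewrite /= ?eqxx ?orbT.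
Qed.

Section Walk.
Variables (S : {fset cell}) (J : cell -> cell -> int).

Inductive walk (c : cell) : cell -> int -> Prop :=
| walk_nil : c \in S -> walk c c 0
| walk_rcons b b' v : walk c b v -> b' \in S -> near_cells b b' ->
    walk c b' (v + J b b').

Lemma walk_trans c d e v w : walk c d v -> walk d e w -> walk c e (v + w).
Proof.
move=> cd; elim=> [_|b b' w' _ IH b'S bb']; first by rewrite addr0.
by rewrite addrA; exact: walk_rcons.
Qed.

Lemma walk_fun c d v : walk c d v -> exists n (f : nat -> cell),
  [/\ f 0%N = c, f n = d, forall i, (i <= n)%N -> f i \in S,
    forall i, (i < n)%N -> near_cells (f i) (f i.+1) &
    v = \sum_(i < n) J (f i) (f i.+1)].
Proof.
elim=> [cS|b b' w _ [n [f [f0 fn fS fnear ->]]] b'S bb'].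
  by exists 0%N, (fun=> c); split=> //; rewrite big_ord0.
exists n.+1, (fun i => if (i <= n)%N then f i else b'); split.
- by [].
- by rewrite ltnn.
- by move=> i; case: ifP => // iN _; exact: fS.
- move=> i iN; have iN' : (i <= n)%N by [].
  rewrite iN'; case: (ltnP i n) => ni; first exact: fnear.
  by rewrite (_ : i = n) ?fn//; apply/eqP; rewrite eqn_leq iN'.
- rewrite big_ord_recr /= leqnn ltnn fn; congr (_ + _).
  by apply: eq_bigr => i _; rewrite ltnW ltn_ord.
Qed.

End Walk.

(** [P] integrates [J] along walks from a base cell. Closed walks have value 0 by [region_loop], so
    [xget] picks from a one-element set. *)
Lemma region_nerve_exact (K : realType) (S : {fset cell}) (J : cell -> cell -> int) :
  region K S -> nerve_cocycle S J ->
  exists P : cell -> int, forall c c', c \in S -> c' \in S -> near_cells c c' ->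
    P c' = P c + J c c'.
Proof.
move=> rS hJ.
have conn c c' : c \in S -> c' \in S -> exists v, walk S J c c' v.
  move=> cS c'S; apply: (region_connected rS (P := fun d => exists v, walk S J c d v) _ cS c'S).
    by move=> d e dS eS de [v cd]; exists (v + J d e); exact: walk_rcons.
  by exists 0; exact: walk_nil.
have loop c v : walk S J c c v -> v = 0.
  move=> /walk_fun[n [f [f0 fn fS fnear ->]]].
  by apply: region_loop rS hJ fS fnear _; rewrite fn f0.
have [[c0 c0S]|noS] := pselect (exists c, c \in S); last first.
  by exists (fun=> 0) => c c' cS; case: noS; exists c.
exists (fun c => xget 0 [set v | walk S J c0 c v]) => c c' cS c'S cc'.
case: xgetP => [v' _ w'|h]; last first.
  by have [v cv] := conn _ _ c0S c'S; case: (h v).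
case: xgetP => [v _ w|h]; last first.
  by have [v cv] := conn _ _ c0S cS; case: (h v).
have [u wu] := conn _ _ c'S c0S.
have := loop _ _ (walk_trans w' wu).
have := loop _ _ (walk_trans (walk_rcons w c'S cc') wu).
by lia.
Qed.

(** * Potentials of closed cochains on lattice points *)

Definition corner (c : cell) (v : vertex) : bool :=
  ((v.1 == c.1) || (v.1 == c.1 + 1)) && ((v.2 == c.2) || (v.2 == c.2 + 1)).

(* A 1-cochain on the unit edges of the plane: [a v] is its value on the edge
   from [v] to the east, [b v] on the edge from [v] to the north. *)
Definition closed_at (a b : vertex -> int) (c : cell) : Prop :=
  a c + b (c.1 + 1, c.2) = a (c.1, c.2 + 1) + b c.

Definition potential_at (a b : vertex -> int) (phi : vertex -> int) (c : cell) : Prop :=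
  [/\ phi (c.1 + 1, c.2) - phi (c.1, c.2) = a (c.1, c.2),
      phi (c.1 + 1, c.2 + 1) - phi (c.1, c.2 + 1) = a (c.1, c.2 + 1),
      phi (c.1, c.2 + 1) - phi (c.1, c.2) = b (c.1, c.2) &
      phi (c.1 + 1, c.2 + 1) - phi (c.1 + 1, c.2) = b (c.1 + 1, c.2)].

Section LocalPotential.
Variables (a b : vertex -> int).

Definition local_potential (c : cell) (v : vertex) : int :=
  if v.1 == c.1 then (if v.2 == c.2 then 0 else b c)
  else a c + (if v.2 == c.2 then 0 else b (c.1 + 1, c.2)).

Lemma local_potential_at c : closed_at a b c -> potential_at a b (local_potential c) c.
Proof.
case: c => i j; rewrite /closed_at /potential_at /local_potential /= !eqxx.
have n1 (k : int) : (k + 1 == k) = false by lia.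
by rewrite !n1 => h; split; lia.
Qed.

(** Distinct cells share at most the two ends of one edge, and along that edge both potentials grow
    by the same cochain value; so on common corners they differ by a constant. *)
Lemma local_potential_common c c' v v' :
  closed_at a b c -> closed_at a b c' ->
  corner c v -> corner c' v -> corner c v' -> corner c' v' ->
  local_potential c v - local_potential c' v =
  local_potential c v' - local_potential c' v'.
Proof.
move=> /local_potential_at[+ + + +] /local_potential_at[].
case: c c' v v' => [i j] [i' j'] [x y] [x' y']; rewrite /corner /=.
have [<-|ii'] := eqVneq i i'; have [<-|jj'] := eqVneq j j'.
- by lia.
- move=> h1 h2 _ _ h3 h4 _ _ c1 c2 c3 c4.
  have yy' : y = y' by lia.
  subst y'; have [jy|jy] : y = j /\ y = j' + 1 \/ y = j + 1 /\ y = j' by lia.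
    move: h1 h4; rewrite -jy.2 -jy.1; have [ex|ex] : x = i \/ x = i + 1 by lia.
      have [->|->] : x' = i \/ x' = i + 1 by lia.
        by rewrite ex; lia.
      by rewrite ex; lia.
    have [->|->] : x' = i \/ x' = i + 1 by lia.
        by rewrite ex; lia.
      by rewrite ex; lia.
  move: h2 h3; rewrite -jy.2 -jy.1; have [ex|ex] : x = i \/ x = i + 1 by lia.
    have [->|->] : x' = i \/ x' = i + 1 by lia.
        by rewrite ex; lia.
      by rewrite ex; lia.
  have [->|->] : x' = i \/ x' = i + 1 by lia.
        by rewrite ex; lia.
      by rewrite ex; lia.
- move=> _ _ h1 h2 _ _ h3 h4 c1 c2 c3 c4.
  have xx' : x = x' by lia.
  subst x'; have [jy|jy] : x = i /\ x = i' + 1 \/ x = i + 1 /\ x = i' by lia.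
    move: h1 h4; rewrite -jy.2 -jy.1; have [ex|ex] : y = j \/ y = j + 1 by lia.
      have [->|->] : y' = j \/ y' = j + 1 by lia.
        by rewrite ex; lia.
      by rewrite ex; lia.
    have [->|->] : y' = j \/ y' = j + 1 by lia.
        by rewrite ex; lia.
      by rewrite ex; lia.
  move: h2 h3; rewrite -jy.2 -jy.1; have [ex|ex] : y = j \/ y = j + 1 by lia.
    have [->|->] : y' = j \/ y' = j + 1 by lia.
        by rewrite ex; lia.
      by rewrite ex; lia.
  have [->|->] : y' = j \/ y' = j + 1 by lia.
        by rewrite ex; lia.
      by rewrite ex; lia.
- move=> _ _ _ _ _ _ _ _ c1 c2 c3 c4.
  have [-> ->] : x = x' /\ y = y' by lia.
  by [].
Qed.

End LocalPotential.

(** The constants between local potentials of near cells form a cocycle [J]. A primitive of [J]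
    shifts the local potentials so that they agree on common corners. *)
Lemma region_exact (K : realType) (S : {fset cell}) (a b : vertex -> int) :
  region K S -> (forall c, c \in S -> closed_at a b c) ->
  exists phi : vertex -> int, forall c, c \in S -> potential_at a b phi c.
Proof.
move=> rS hab.
pose L := local_potential a b.
pose V (c c' : cell) : vertex := (Num.max c.1 c'.1, Num.max c.2 c'.2).
have Vc c c' : near_cells c c' -> corner c (V c c') /\ corner c' (V c c').
  by case: c c' => [i j] [i' j']; rewrite /near_cells /corner /V /=; lia.
pose J c c' := L c (V c c') - L c' (V c c').
have JE c c' v : c \in S -> c' \in S -> corner c v -> corner c' v ->
    J c c' = L c v - L c' v.
  move=> cS c'S cv c'v.
  have [] : corner c (V c c') /\ corner c' (V c c').
    apply: Vc; move: cv c'v; case: c c' v {cS c'S} => [i j] [i' j'] [x y].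
    by rewrite /near_cells /corner /=; lia.
  by move=> h1 h2; apply: local_potential_common => //; exact: hab.
have hJ : nerve_cocycle S J.
  move=> c c' c'' cS c'S c''S h1 h2 h3.
  (* Three pairwise near cells have a common corner, where all three constants can be read off. *)
  pose v : vertex := (Num.max c.1 (Num.max c'.1 c''.1), Num.max c.2 (Num.max c'.2 c''.2)).
  have [cv c'v c''v] : [/\ corner c v, corner c' v & corner c'' v].
    move: h1 h2 h3; rewrite /v; clear; case: c c' c'' => [i j] [i' j'] [i'' j''].
    by rewrite /near_cells /corner /= => h1 h2 h3; split; lia.
  by rewrite !(JE _ _ v)//; lia.
have [P hP] := region_nerve_exact rS hJ.
pose phi v := xget 0 [set z | exists2 c, c \in S & corner c v /\ z = P c + L c v].
have phiE c v : c \in S -> corner c v -> phi v = P c + L c v.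
  move=> cS cv; rewrite /phi; case: xgetP => [z _ [c' c'S [c'v ->]]|h].
    have cc' : near_cells c c'.
      move: cv c'v; clear; case: c c' v => [i j] [i' j'] [x y].
      by rewrite /near_cells /corner /=; lia.
    by rewrite (hP c c')// (JE c c' v)//; lia.
  by case: (h (P c + L c v)); exists c.
exists phi => c cS.
have [h1 h2 h3 h4] := local_potential_at (hab c cS).
by split; rewrite !(phiE c) // /corner /= ?eqxx ?orbT// opprD addrACA subrr add0r.
Qed.

Lemma region_vertex_const (K : realType) (S : {fset cell}) (A : Type) (f : vertex -> A) :
  region K S ->
  (forall c v v', c \in S -> corner c v -> corner c v' -> f v = f v') ->
  forall c c' v v', c \in S -> c' \in S -> corner c v -> corner c' v' -> f v = f v'.
Proof.
move=> rS hf c c' v v' cS c'S cv.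
apply: (region_connected rS (P := fun d => forall w, corner d w -> f v = f w) _ cS c'S).
  move=> d e dS eS de IH w ew.
  pose u : vertex := (Num.max d.1 e.1, Num.max d.2 e.2).
  have [du eu] : corner d u /\ corner e u.
    by move: de; rewrite /u; clear; case: d e => [i j] [i' j']; rewrite /near_cells /corner /=; lia.
  by rewrite (IH u du); exact: hf eS eu ew.
by move=> w; exact: hf cS cv.
Qed.

(** * Tilings and height functions *)

Definition adj (c c' : cell) : bool :=
  [|| c' == (c.1 + 1, c.2), c' == (c.1 - 1, c.2), c' == (c.1, c.2 + 1)
    | c' == (c.1, c.2 - 1)].

Lemma adjE c c' : adj c c' = (`|c.1 - c'.1| + `|c.2 - c'.2| == 1).
Proof.
case: c c' => [i j] [i' j']; rewrite /adj /= !xpair_eqE /=.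
by apply/idP/idP; lia.
Qed.

Lemma adj_sym c c' : adj c c' = adj c' c.
Proof. by rewrite !adjE distrC (distrC c.2). Qed.

Lemma adj_neq c c' : adj c c' -> c != c'.
Proof. by rewrite adjE; apply: contraTneq => ->; rewrite !subrr. Qed.

Lemma white_adj c c' : adj c c' -> white c' = ~~ white c.
Proof.
rewrite adjE; case: c c' => [i j] [i' j']; rewrite /white /=.
by move=> h; apply/idP/idP; lia.
Qed.

Definition sgn (v : vertex) : int := if white v then 1 else -1.

Lemma sgn_adj c c' : adj c c' -> sgn c' = - sgn c.
Proof. by move=> h; rewrite /sgn (white_adj h); case: white. Qed.

Definition cross (T : {fset {fset cell}}) (l r : cell) : bool :=
  [fset l; r]%fset \in T.

Lemma crossC T l r : cross T l r = cross T r l.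
Proof. by rewrite /cross fsetUC. Qed.

Lemma fset2_inj (c x y : cell) : x != c -> [fset c; x]%fset = [fset c; y]%fset -> x = y.
Proof.
move=> xc /fsetP /(_ x); rewrite !in_fset2 eqxx orbT (negPf xc) /=.
by move/esym/eqP.
Qed.

Lemma domino_partner d c : is_domino d -> c \in d ->
  exists2 c', adj c c' & d = [fset c; c']%fset.
Proof.
case=> i [j [->|->]]; rewrite in_fset2 => /orP[]/eqP->.
- by exists (i + 1, j); rewrite // adjE /=; lia.
- by exists (i, j); [rewrite adjE /=; lia|rewrite fsetUC].
- by exists (i, j + 1); rewrite // adjE /=; lia.
- by exists (i, j); [rewrite adjE /=; lia|rewrite fsetUC].
Qed.

Lemma domino_adj c c' : is_domino [fset c; c']%fset -> adj c c'.
Proof.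
move=> h; have [|d cd e] := domino_partner (c := c) h; first by rewrite in_fset2 eqxx.
by rewrite -(fset2_inj _ (esym e)) // eq_sym adj_neq.
Qed.

Lemma adj_domino c c' : adj c c' -> is_domino [fset c; c']%fset.
Proof.
case: c => i j /or4P[]/eqP-> /=.
- by exists i, j; left.
- by exists (i - 1), j; left; rewrite subrK fsetUC.
- by exists i, j; right.
- by exists i, (j - 1); right; rewrite subrK fsetUC.
Qed.

Section Tiling.
Variables (S : {fset cell}) (T : {fset {fset cell}}).
Hypothesis tT : is_tiling S T.

Lemma cross_mem l r : cross T l r -> l \in S /\ r \in S.
Proof.
move=> /(proj1 tT)[_ /fsubsetP h]; split; apply: h; rewrite in_fset2 eqxx ?orbT//.
Qed.

Lemma tiling_unique c d d' : d \in T -> d' \in T -> c \in d -> c \in d' -> d = d'.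
Proof.
move=> dT d'T cd cd'; have cS : c \in S by have [_ /fsubsetP] := proj1 tT d dT; exact.
by have [e [_ h]] := proj2 tT c cS; rewrite -(h d) // -(h d').
Qed.

Lemma tiling_partner c : c \in S ->
  exists2 c', adj c c' & forall e, cross T c e = (e == c').
Proof.
move=> cS; have [d [[dT cd] _]] := proj2 tT c cS.
have [c' cc' dE] := domino_partner (proj1 (proj1 tT d dT)) cd; exists c' => // e.
apply/idP/eqP => [h|->]; last by rewrite /cross -dE.
apply/esym; apply: (@fset2_inj c); first by rewrite eq_sym adj_neq.
rewrite -dE; apply: (@tiling_unique c) => //; rewrite in_fset2 eqxx //.
Qed.

Lemma domino_cross d c e : d \in T -> c \in d -> e \in d -> c != e -> cross T c e.
Proof.
move=> dT cd ed ce; have [c' cc' dE] := domino_partner (proj1 (proj1 tT d dT)) cd.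
move: ed; rewrite dE in_fset2 eq_sym (negPf ce) /= => /eqP ->.
by rewrite /cross -dE.
Qed.

(* The increments of a height function along the east and north edges at v. *)
Definition diffE (v : vertex) : int := sgn v * (if cross T v (v.1, v.2 - 1) then 3 else -1).
Definition diffN (v : vertex) : int := sgn v * (if cross T (v.1 - 1, v.2) v then -3 else 1).

(** Counterclockwise around [c] the increments are [- sgn c], except [3 * sgn c] on the one side
    crossed by the domino of [c]; they sum to 0. *)
Lemma diff_closed c : c \in S -> closed_at diffE diffN c.
Proof.
move=> cS; rewrite /closed_at /diffE /diffN /=.
have aE : adj c (c.1 + 1, c.2) by rewrite adjE /=; lia.
have aN : adj c (c.1, c.2 + 1) by rewrite adjE /=; lia.
rewrite (sgn_adj aE) (sgn_adj aN) !addrK -!surjective_pairing.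
rewrite (crossC T (c.1, c.2 + 1)) (crossC T (c.1 - 1, c.2)).
have [c' + hc'] := tiling_partner cS; rewrite !hc' {hc' aE aN}.
by case: c {cS} => i j; rewrite /adj /sgn /= => /or4P[]/eqP->;
  rewrite !xpair_eqE /= !eqxx; case: white;
  do ![case: eqP => //=; try lia].
Qed.

Definition heightlike (h : vertex -> int) : Prop :=
  forall c, c \in S -> potential_at diffE diffN h c.

Lemma heightlike_E h v : heightlike h -> v \in S \/ (v.1, v.2 - 1) \in S ->
  h (v.1 + 1, v.2) - h v = diffE v.
Proof.
case: v => i j hh [/hh[]|/hh[]] //=.
by rewrite subrK.
Qed.

Lemma heightlike_N h v : heightlike h -> v \in S \/ (v.1 - 1, v.2) \in S ->
  h (v.1, v.2 + 1) - h v = diffN v.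
Proof.
case: v => i j hh [/hh[]|/hh[]] //=.
by rewrite subrK.
Qed.

Lemma edge_not_cross l r : edge_in_tiling T l r -> cross T l r = false.
Proof.
case=> d dT; apply: contraTF => lr.
have lin : l \in [fset l; r]%fset by rewrite in_fset2 eqxx.
have rin : r \in [fset l; r]%fset by rewrite in_fset2 eqxx orbT.
have [ld|/negPf ld] := boolP (l \in d).
  by rewrite (tiling_unique dT lr ld lin) rin.
have [rd|//] := boolP (r \in d).
by rewrite (tiling_unique dT lr rd rin) lin in ld.
Qed.

Lemma edge_in_tiling_mem l r : edge_in_tiling T l r -> l \in S \/ r \in S.
Proof.
case=> d dT; have [_ /fsubsetP dS] := proj1 tT d dT.
by have [ld _|_ rd] := boolP (l \in d); [left|right]; exact: dS.
Qed.

Lemma not_cross_edge l r : l != r -> l \in S \/ r \in S -> cross T l r = false ->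
  edge_in_tiling T l r.
Proof.
move=> lr; case=> [lS|rS] nc.
  have [d [[dT ld] _]] := proj2 tT l lS; exists d => //; rewrite ld /=.
  by apply: contraFN nc => rd; exact: domino_cross ld rd lr.
have [d [[dT rd] _]] := proj2 tT r rS; exists d => //; rewrite rd addbT.
by apply: contraFN nc => ld; exact: domino_cross ld rd lr.
Qed.

Lemma heightlike_is_height h : heightlike h -> is_height T h.
Proof.
move=> hh x y l r e elr wl.
have lrS := edge_in_tiling_mem elr; have nc := edge_not_cross elr.
have wN (a b : int) : white (a - 1, b) -> white (a, b) = false.
  have ad : adj (a - 1, b) (a, b) by rewrite adjE /=; lia.
  by move=> w; rewrite (white_adj ad) w.
have wS (a b : int) : white (a, b - 1) -> white (a, b) = false.
  have ad : adj (a, b - 1) (a, b) by rewrite adjE /=; lia.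
  by move=> w; rewrite (white_adj ad) w.
case: e elr wl lrS nc => a b _ wl lrS nc.
- by have := heightlike_E hh lrS; rewrite /diffE /sgn /= wl nc /=; do ![move: (h _) => ?]; lia.
- have := @heightlike_N h (a, b) hh; rewrite /diffN /sgn /= nc (wN _ _ wl) /=.
  by case: lrS => [h1 /(_ (or_intror h1))|h1 /(_ (or_introl h1))]; do ![move: (h _) => ?]; lia.
- have := @heightlike_E h (a, b) hh; rewrite /diffE /sgn /= crossC nc (wS _ _ wl) /=.
  by case: lrS => [h1 /(_ (or_intror h1))|h1 /(_ (or_introl h1))]; do ![move: (h _) => ?]; lia.
- have := @heightlike_N h (a, b) hh; rewrite /diffN /sgn /= crossC nc wl /=.
  by case: lrS => [h1 /(_ (or_introl h1))|h1 /(_ (or_intror h1))]; do ![move: (h _) => ?]; lia.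
Qed.

Lemma is_height_E h v : is_height T h -> v \in S \/ (v.1, v.2 - 1) \in S ->
  cross T v (v.1, v.2 - 1) = false -> h (v.1 + 1, v.2) - h v = diffE v.
Proof.
case: v => a b hh vS nc; rewrite /diffE /sgn nc /=.
have ad : adj (a, b) (a, b - 1) by rewrite adjE /=; lia.
have ne := adj_neq ad.
have [w|w] := boolP (white (a, b)).
  by have := hh _ _ _ _ (East a b) (not_cross_edge ne vS nc) w; rewrite /=; do ![move: (h _) => ?]; lia.
have e : edge_in_tiling T (a, b - 1) (a, b).
  by apply: not_cross_edge; [rewrite eq_sym|by case: vS; [right|left]|rewrite crossC].
by have := hh _ _ _ _ (West a b) e; rewrite (white_adj ad) w /= => /(_ isT); do ![move: (h _) => ?]; lia.
Qed.

Lemma is_height_N h v : is_height T h -> v \in S \/ (v.1 - 1, v.2) \in S ->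
  cross T (v.1 - 1, v.2) v = false -> h (v.1, v.2 + 1) - h v = diffN v.
Proof.
case: v => a b hh vS nc; rewrite /diffN /sgn nc /=.
have ad : adj (a, b) (a - 1, b) by rewrite adjE /=; lia.
have ne := adj_neq ad.
have [w|w] := boolP (white (a, b)).
  by have := hh _ _ _ _ (South a b) (not_cross_edge ne vS _) w;
    rewrite /= crossC => /(_ nc); do ![move: (h _) => ?]; lia.
have e : edge_in_tiling T (a - 1, b) (a, b).
  by apply: not_cross_edge; [rewrite eq_sym|by case: vS; [right|left]|].
by have := hh _ _ _ _ (North a b) e; rewrite (white_adj ad) w /= => /(_ isT); do ![move: (h _) => ?]; lia.
Qed.

(** [is_height] prescribes the increments on the three sides of a cell that bound its domino; the
    fourth follows because both [h] and the cochain close up around the cell. *)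
Lemma is_height_heightlike h : is_height T h -> heightlike h.
Proof.
move=> hh c cS.
have := diff_closed cS; have [c' cc' hc'] := tiling_partner cS.
case: c cS cc' hc' => i j cS cc' hc'.
have eS := @is_height_E h (i, j) hh (or_introl cS).
have eW := @is_height_N h (i, j) hh (or_introl cS).
have eN : cross T (i, j + 1) (i, j) = false ->
    h (i + 1, j + 1) - h (i, j + 1) = diffE (i, j + 1).
  by have := @is_height_E h (i, j + 1) hh; rewrite /= addrK; apply; right.
have eE : cross T (i, j) (i + 1, j) = false ->
    h (i + 1, j + 1) - h (i + 1, j) = diffN (i + 1, j).
  by have := @is_height_N h (i + 1, j) hh; rewrite /= addrK; apply; right.
move: eS eW eN eE; rewrite /closed_at /potential_at /= (crossC _ (i - 1, j)).
rewrite (crossC _ (i, j + 1)) !hc'; case/or4P: cc' => /eqP -> /=; rewrite !xpair_eqE /=.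
all: do ![move: (h _) => ?]; do ![move: (diffE _) => ?]; do ![move: (diffN _) => ?].
all: by move=> h1 h2 h3 h4 h5; split; lia.
Qed.

End Tiling.

Lemma height_spec (K : realType) (S : {fset cell}) (T : {fset {fset cell}}) (p : vertex) :
  region K S -> is_tiling S T -> heightlike S T (height T p) /\ height T p p = 0.
Proof.
move=> rS tT; have [phi hphi] := region_exact rS (diff_closed tT).
rewrite /height; case: xgetP => [h _ [hh hp]|/(_ (fun v => phi v - phi p)) []].
  by split=> //; exact: is_height_heightlike.
split; last by rewrite subrr.
apply: (heightlike_is_height tT (h := fun v => phi v - phi p)) => c cS; have [h1 h2 h3 h4] := hphi c cS.
by split; rewrite opprD addrACA subrr addr0.
Qed.

(** * Two height functions agree on the boundary *)

Definition ind (b : bool) : int := if b then 1 else 0.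

Lemma sum_tail_diff (g : int -> int) (z i : int) (N : nat) :
  \sum_(n < N) (g (z + n%:Z + 1) - g (z + n%:Z)) * ind (i <= z + n%:Z) =
  if i <= z + N%:Z then g (z + N%:Z) - g (Num.max i z) else 0.
Proof.
elim: N => [|N IH].
  rewrite big_ord0 addr0; case: ifP => // iz.
  by rewrite (_ : Num.max i z = z) ?subrr//; lia.
rewrite big_ord_recr /= IH -addn1 PoszD addrA /ind.
have [h|h] := leP i (z + N%:Z).
  by rewrite (_ : i <= z + N%:Z + 1); last (by lia); ring.
case: ifP => h'; last by rewrite mulr0 addr0.
by rewrite (_ : Num.max i z = z + N%:Z + 1) ?subrr ?mulr0 ?addr0//; lia.
Qed.

Lemma sum_tail_step (g : int -> int) (z i : int) (N : nat) :
  \sum_(n < N) g (z + n%:Z) * (ind (i <= z + n%:Z) - ind (i + 1 <= z + n%:Z)) =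
  if z <= i < z + N%:Z then g i else 0.
Proof.
elim: N => [|N IH].
  by rewrite big_ord0; case: ifP => //; lia.
rewrite big_ord_recr /= IH -addn1 PoszD addrA /ind.
have [h|h] := eqVneq i (z + N%:Z).
  rewrite h (_ : (z <= z + N%:Z < z + N%:Z) = false); last by lia.
  rewrite lexx (_ : (z + N%:Z + 1 <= z + N%:Z) = false); last by lia.
  by rewrite (_ : z <= z + N%:Z < z + N%:Z + 1); [ring|lia].
rewrite (_ : (z <= i < z + N%:Z + 1) = (z <= i < z + N%:Z)); last by lia.
rewrite (_ : (i + 1 <= z + N%:Z) = (i <= z + N%:Z)); last by lia.
by rewrite subrr mulr0 addr0.
Qed.

Lemma fset_bounded (S : {fset cell}) : exists2 B : nat, (0 < B)%N &
  forall c, c \in S -> `|c.1| < B%:Z /\ `|c.2| < B%:Z.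
Proof.
exists (\sum_(c <- S) (`|c.1|%N + `|c.2|%N)).+1 => // c cS.
by rewrite (big_fsetD1 c) //=; lia.
Qed.

(* W sums [a] along horizontal rays.  If k is not in S, the cochain counting
   crossings of the ray from k has a potential [phi] on the region, and W k is the
   jump at the row of k of the sums F j of [a * phi], which are constant elsewhere
   and vanish far away. *)
Lemma compact_cochain_potential (K : realType) (S : {fset cell}) (a b : vertex -> int) :
  region K S -> (forall c, closed_at a b c) ->
  (forall v, a v != 0 -> v \in S /\ (v.1, v.2 - 1) \in S) ->
  (forall v, b v != 0 -> v \in S /\ (v.1 - 1, v.2) \in S) ->
  exists W : vertex -> int, (forall c, potential_at a b W c) /\
    (forall k v, k \notin S -> corner k v -> W v = 0).
Proof.
move=> rS hab aS bS; have [B B0 hB] := fset_bounded S.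
pose z := - B%:Z; pose N := B.*2.
have a0 i j : ~~ (z < i < B%:Z) || ~~ (z < j < B%:Z) -> a (i, j) = 0.
  move=> h; apply/eqP; apply: contraT => /aS[/hB /= ij _].
  by move: h ij; rewrite /z; lia.
have b0 i j : ~~ (z < i < B%:Z) || ~~ (z < j < B%:Z) -> b (i, j) = 0.
  move=> h; apply/eqP; apply: contraT => /bS[/hB /= ij _].
  by move: h ij; rewrite /z; lia.
have zN : z + N%:Z = B%:Z by rewrite /z /N; lia.
have da i j : a (i, j + 1) - a (i, j) = b (i + 1, j) - b (i, j).
  by have := hab (i, j); rewrite /closed_at /=; move: (a _) (a _) (b _) (b _); lia.
pose W (v : vertex) := - \sum_(n < N) a (z + n%:Z, v.2) * ind (v.1 <= z + n%:Z).
have WE i j : W (i + 1, j) - W (i, j) = a (i, j).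
  rewrite /W /= opprK addrC -sumrB.
  under eq_bigr do rewrite -mulrBr.
  rewrite (sum_tail_step (fun i => a (i, j))) zN; case: ifP => // h.
  by rewrite a0//; lia.
have WN i j : W (i, j + 1) - W (i, j) = b (i, j).
  rewrite /W /= opprK addrC -sumrB.
  under eq_bigr do rewrite -mulrBl -opprB da opprB -[b _ - _]opprB mulNr.
  rewrite sumrN (sum_tail_diff (fun i => b (i, j))) zN.
  rewrite (b0 B%:Z j); last by lia.
  case: ifP => h; last by rewrite (b0 i)//; lia.
  have [iz|iz] := leP i z; first by rewrite b0 ?(b0 i)//; lia.
  by rewrite sub0r opprK.
have W0 k : k \notin S -> W k = 0.
  case: k => k1 k2 kS.
  (* Closed at every cell except [k], where the ray starts; this is where [k \notin S] enters. *)
  pose th (v : vertex) : int := ind ((v.2 == k2) && (k1 < v.1)).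
  have hth c : c \in S -> closed_at (fun=> 0) th c.
    case: c => i j cS; rewrite /closed_at /th /= add0r add0r; congr ind.
    have [jk|//] := eqVneq j k2; have [ik|] := eqVneq i k1; last by lia.
    by move: kS; rewrite -jk -ik cS.
  have [phi hphi] := region_exact rS hth.
  pose F j := \sum_(n < N) a (z + n%:Z, j) * phi (z + n%:Z + 1, j).
  have FS j : F (j + 1) - F j = ind (j == k2) * - W (k1, k2).
    have step (n : 'I_N) : a (z + n%:Z, j + 1) * phi (z + n%:Z + 1, j + 1) -
        a (z + n%:Z, j) * phi (z + n%:Z + 1, j) =
        (b (z + n%:Z + 1, j) * phi (z + n%:Z + 1, j + 1) - b (z + n%:Z, j) * phi (z + n%:Z, j + 1))
        + a (z + n%:Z, j) * th (z + n%:Z + 1, j).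
      set i := z + n%:Z.
      (* [phi] is a potential of [th] only along sides of cells of [S]. A nonzero [a (i, j)] or
         [b (i, j)] puts the cell [(i, j)] in [S]; otherwise both sides vanish. *)
      have e1 : a (i, j) * phi (i + 1, j) = a (i, j) * (phi (i + 1, j + 1) - th (i + 1, j)).
        have [->|/aS[/hphi[_ _ _ /= <-] _]] := eqVneq (a (i, j)) 0; first by rewrite !mul0r.
        by rewrite opprB addrCA subrr addr0.
      have e2 : b (i, j) * phi (i, j + 1) = b (i, j) * phi (i + 1, j + 1).
        have [->|/bS[/hphi[_ /= /subr0_eq -> //]]] := eqVneq (b (i, j)) 0.
        by rewrite !mul0r.
      rewrite e1 e2 -mulrBl -da; ring.
    rewrite /F -sumrB (eq_bigr _ (fun n _ => step n)) big_split /=.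
    have -> : \sum_(n < N) (b (z + n%:Z + 1, j) * phi (z + n%:Z + 1, j + 1) -
        b (z + n%:Z, j) * phi (z + n%:Z, j + 1)) = 0.
      have := sum_tail_diff (fun i => b (i, j) * phi (i, j + 1)) z z N.
      rewrite zN (b0 B%:Z j); last by lia.
      rewrite (_ : Num.max z z = z) ?maxxx// (b0 z j); last by lia.
      rewrite !mul0r subr0 if_same => e; rewrite -[RHS]e; apply: eq_bigr => n _.
      by rewrite /ind (_ : z <= z + n%:Z) ?mulr1//; lia.
    rewrite add0r /W opprK /= /th /=; have [jk|_] := eqVneq j k2; last first.
      by rewrite mul0r big1// => n _; rewrite /ind mulr0.
    rewrite /ind mul1r jk; apply: eq_bigr => n _ /=.
    by rewrite (_ : (k1 < z + n%:Z + 1) = (k1 <= z + n%:Z))//; lia.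
  have F0 j : ~~ (z < j < B%:Z) -> F j = 0.
    by move=> h; rewrite /F big1// => n _; rewrite a0 ?h ?orbT// mul0r.
  have FW m : F (z + m%:Z) = ind ((z <= k2) && (k2 < z + m%:Z)) * - W (k1, k2).
    elim: m => [|m IH].
      rewrite addr0 F0 ?ltxx// /ind; case: ifP => [|_]; [lia|by rewrite mul0r].
    have := FS (z + m%:Z); rewrite IH -addn1 PoszD addrA /ind.
    have [e|h] := eqVneq (z + m%:Z) k2.
      have zk : z <= k2 by lia.
      have kk : k2 < k2 + 1 by lia.
      by rewrite e zk kk ltxx /= mul0r subr0.
    rewrite mul0r => /subr0_eq ->; rewrite (_ : (k2 < z + m%:Z + 1) = (k2 < z + m%:Z))//.
    by lia.
  have := FW N; rewrite zN F0; last by lia.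
  rewrite /ind; case: ifP => h.
    by rewrite mul1r => /esym/eqP; rewrite oppr_eq0 => /eqP.
  move=> _; rewrite /W big1 ?oppr0//= => n _; rewrite a0 ?mul0r//.
  by lia.
exists W; split.
  by case=> i j; split => /=; rewrite ?WE ?WN.
case=> i j v kS; have ak : a (i, j) = 0 by apply/eqP; apply: contraNT kS => /aS[].
have bk : b (i, j) = 0 by apply/eqP; apply: contraNT kS => /bS[].
have ak' : a (i, j + 1) = 0.
  by apply/eqP; apply: contraNT kS => /aS[_]; rewrite /= addrK.
have w1 := W0 _ kS; have := WE i j; have := WN i j; have := WE i (j + 1).
rewrite ak bk ak' w1 !subr0 => w3 w2 w4; move: w3; rewrite w2 subr0 => w3.
by case: v => x y /andP[/= /orP[]/eqP-> /orP[]/eqP->].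
Qed.

(** Both values are [- s] modulo 4, the source of the congruences modulo 4 below. *)
Definition step (s d : int) : bool := (d == - s) || (d == 3 * s).

(* The steps of a height function counterclockwise around the cell [c]. *)
Definition local_height (h : vertex -> int) (c : cell) : bool :=
  [&& step (sgn c) (h (c.1 + 1, c.2) - h (c.1, c.2)),
      step (sgn c) (h (c.1 + 1, c.2 + 1) - h (c.1 + 1, c.2)),
      step (sgn c) (h (c.1, c.2 + 1) - h (c.1 + 1, c.2 + 1)) &
      step (sgn c) (h (c.1, c.2) - h (c.1, c.2 + 1))].

Lemma sgn_cases c : sgn c = 1 \/ sgn c = -1.
Proof. by rewrite /sgn; case: white; [left|right]. Qed.

Lemma heightlike_local S T h c : is_tiling S T -> heightlike S T h -> c \in S ->
  local_height h c.
Proof.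
move=> tT hh cS; have [h1 h2 h3 h4] := hh c cS; rewrite /local_height /step.
have aE : adj c (c.1 + 1, c.2) by rewrite adjE /=; lia.
have aN : adj c (c.1, c.2 + 1) by rewrite adjE /=; lia.
move: h1 h2 h3 h4; rewrite /diffE /diffN (sgn_adj aE) (sgn_adj aN) -!surjective_pairing.
move: (h c) (h _) (h _) (h _) => x1 x2 x3 x4.
by have [->|->] := sgn_cases c; do 4 case: (cross T _ _) => /=; lia.
Qed.

(** Exactly one of the four steps is a 3, so opposite corners differ by exactly 2. This saving over
    the 3 of a single edge is what [ball_height] exploits. *)
Lemma local_height_dist h c v v' : local_height h c -> corner c v -> corner c v' ->
  `|h v - h v'| <= 2 + (~~ (2 %| (v.1 + v.2) - (v'.1 + v'.2)))%Z%:Z.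
Proof.
case: c v v' => i j [x y] [x' y'] /and4P[] /= h1 h2 h3 h4 c1 c2.
move: h1 h2 h3 h4; rewrite /step.
have [->|->] := sgn_cases (i, j).
all: have [->|->] : x = i \/ x = i + 1 by move: c1; rewrite /corner /=; lia.
all: have [->|->] : x' = i \/ x' = i + 1 by move: c2; rewrite /corner /=; lia.
all: have [->|->] : y = j \/ y = j + 1 by move: c1; rewrite /corner /=; lia.
all: have [->|->] : y' = j \/ y' = j + 1 by move: c2; rewrite /corner /=; lia.
all: move: (h _) (h _) (h _) (h _) => x1 x2 x3 x4; lia.
Qed.

Lemma local_height_mod h h' c v v' : local_height h c -> local_height h' c ->
  corner c v -> corner c v' -> ((h v - h' v) %% 4)%Z = ((h v' - h' v') %% 4)%Z.
Proof.
case: c v v' => i j [x y] [x' y'] /and4P[] /= h1 h2 h3 h4 /and4P[] /= k1 k2 k3 k4 c1 c2.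
move: h1 h2 h3 h4 k1 k2 k3 k4; rewrite /step.
have [->|->] := sgn_cases (i, j).
all: have [->|->] : x = i \/ x = i + 1 by move: c1; rewrite /corner /=; lia.
all: have [->|->] : x' = i \/ x' = i + 1 by move: c2; rewrite /corner /=; lia.
all: have [->|->] : y = j \/ y = j + 1 by move: c1; rewrite /corner /=; lia.
all: have [->|->] : y' = j \/ y' = j + 1 by move: c2; rewrite /corner /=; lia.
all: move: (h _) (h _) (h _) (h _) (h' _) (h' _) (h' _) (h' _) => x1 x2 x3 x4 x5 x6 x7 x8; clear; lia.
Qed.

Section Heights.
Variables (K : realType) (S : {fset cell}) (T1 T2 : {fset {fset cell}}) (h1 h2 : vertex -> int).
Hypotheses (rS : region K S) (t1 : is_tiling S T1) (t2 : is_tiling S T2).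
Hypotheses (hh1 : heightlike S T1 h1) (hh2 : heightlike S T2 h2).

(** A quarter of the difference of the height increments. It is nonzero only where a domino crosses
    the edge, so both adjacent cells are then in [S], and it is closed on the whole plane. *)
Definition flowE (v : vertex) : int :=
  sgn v * (ind (cross T1 v (v.1, v.2 - 1)) - ind (cross T2 v (v.1, v.2 - 1))).
Definition flowN (v : vertex) : int :=
  - sgn v * (ind (cross T1 (v.1 - 1, v.2) v) - ind (cross T2 (v.1 - 1, v.2) v)).

Lemma diffE_flow v : diffE T1 v - diffE T2 v = 4 * flowE v.
Proof. by rewrite /diffE /flowE /ind; do 2 case: cross; lia. Qed.

Lemma diffN_flow v : diffN T1 v - diffN T2 v = 4 * flowN v.
Proof. by rewrite /diffN /flowN /ind; do 2 case: cross; lia. Qed.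

Lemma flowE_mem v : flowE v != 0 -> v \in S /\ (v.1, v.2 - 1) \in S.
Proof.
rewrite /flowE; case e1: cross; first by move/(cross_mem t1): e1.
by case e2: cross; [move/(cross_mem t2): e2|rewrite subrr mulr0 eqxx].
Qed.

Lemma flowN_mem v : flowN v != 0 -> v \in S /\ (v.1 - 1, v.2) \in S.
Proof.
rewrite /flowN; case e1: cross; first by move/(cross_mem t1): e1 => [].
by case e2: cross; [move/(cross_mem t2): e2 => []|rewrite subrr mulr0 eqxx].
Qed.

Lemma flow_closed c : closed_at flowE flowN c.
Proof.
have [cS|cS] := boolP (c \in S).
  have := diff_closed t1 cS; have := diff_closed t2 cS; rewrite /closed_at.
  have := diffE_flow c; have := diffN_flow c; have := diffE_flow (c.1, c.2 + 1).
  have := diffN_flow (c.1 + 1, c.2).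
  move: (flowE _) (flowE _) (flowN _) (flowN _); move: (diffE _ _) (diffE _ _) (diffE _ _) (diffE _ _).
  by move: (diffN _ _) (diffN _ _) (diffN _ _) (diffN _ _); lia.
rewrite /closed_at.
have -> : flowE c = 0 by apply/eqP; apply: contraNT cS => /flowE_mem[].
have -> : flowN c = 0 by apply/eqP; apply: contraNT cS => /flowN_mem[].
have -> : flowE (c.1, c.2 + 1) = 0.
  by apply/eqP; apply: contraNT cS => /flowE_mem[_]; rewrite /= addrK -surjective_pairing.
have -> // : flowN (c.1 + 1, c.2) = 0.
by apply/eqP; apply: contraNT cS => /flowN_mem[_]; rewrite /= addrK -surjective_pairing.
Qed.

(** [h1 - h2 - 4 * W] is constant on the region, and it is 0 at [p], where the heights agree and the
    outside cell [k0] makes [W] vanish. *)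
Lemma height_difference c0 k0 p : c0 \in S -> corner c0 p -> k0 \notin S -> corner k0 p ->
  h1 p = h2 p ->
  exists W : vertex -> int,
    (forall c v, c \in S -> corner c v -> h1 v - h2 v = 4 * W v) /\
    (forall k v, k \notin S -> corner k v -> W v = 0).
Proof.
move=> c0S c0p k0S k0p hp.
have [W [hW W0]] := compact_cochain_potential rS flow_closed flowE_mem flowN_mem.
exists W; split=> // c v cS cv.
suff : h1 v - h2 v - 4 * W v = h1 p - h2 p - 4 * W p by rewrite hp (W0 _ _ k0S k0p); lia.
apply: (region_vertex_const rS (f := fun v => h1 v - h2 v - 4 * W v) _ cS c0S cv c0p).
move=> {c0 c0S c0p k0 k0S k0p hp c v cS cv} [i j] v v' cS.
suff H w : corner (i, j) w -> h1 w - h2 w - 4 * W w = h1 (i, j) - h2 (i, j) - 4 * W (i, j).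
  by move=> cv cv'; rewrite !H.
have [a1 a2 a3 a4] := hh1 cS; have [b1 b2 b3 b4] := hh2 cS; have [d1 d2 d3 d4] := hW (i, j).
have := diffE_flow (i, j); have := diffN_flow (i, j); have := diffE_flow (i, j + 1).
have := diffN_flow (i + 1, j).
rewrite -a1 -a2 -a3 -a4 -b1 -b2 -b3 -b4 -d1 -d2 -d3 -d4 /=.
case: w => x y; rewrite /corner /= => e1 e2 e3 e4 /andP[/orP[]/eqP-> /orP[]/eqP->].
all: move: e1 e2 e3 e4.
all: move: (h1 _) (h1 _) (h1 _) (h1 _) (h2 _) (h2 _) (h2 _) (h2 _) (W _) (W _) (W _) (W _); lia.
Qed.

End Heights.

(** * The square around a point *)

Definition in_square (x : vertex) (M : int) (c : cell) : bool :=
  (x.1 - M <= c.1 < x.1 + M) && (x.2 - M <= c.2 < x.2 + M).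

Definition cheb (x v : vertex) : int := Num.max `|v.1 - x.1| `|v.2 - x.2|.

(* A height function of the tilings by 2x2 blocks whose corners are congruent to
   q modulo 2; on the borders of the blocks it is within 1 of z. *)
Definition block_height (q : vertex) (z : int) (v : vertex) : int :=
  z + (if (2 %| v.1 - q.1)%Z then if (2 %| v.2 - q.2)%Z then 0 else sgn q
       else if (2 %| v.2 - q.2)%Z then - sgn q else 2).

Lemma dvd2zD (a b : int) : (2 %| a + b)%Z = ((2 %| a)%Z == (2 %| b)%Z).
Proof. by case e1: (2 %| a)%Z; case e2: (2 %| b)%Z; lia. Qed.

Lemma sgn_parity c q :
  sgn c = if (2 %| (c.1 - q.1) + (c.2 - q.2))%Z then sgn q else - sgn q.
Proof.
have e : c.1 + c.2 = (c.1 - q.1) + (c.2 - q.2) + (q.1 + q.2) by ring.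
rewrite /sgn /white e [in LHS]dvd2zD.
by case: (2 %| _ - _ + _)%Z; case: (2 %| _ + _)%Z.
Qed.

Lemma dvd2zS (a b : int) : (2 %| a + 1 - b)%Z = ~~ (2 %| a - b)%Z.
Proof. by lia. Qed.

Lemma block_height_local q z c : local_height (block_height q z) c.
Proof.
rewrite /local_height /block_height /= (sgn_parity c q) dvd2zD /step.
case: c => i j /=.
rewrite !dvd2zS.
by case: (sgn_cases q) => ->; case: (2 %| i - q.1)%Z; case: (2 %| j - q.2)%Z => /=; lia.
Qed.

Lemma step_count s d1 d2 d3 d4 : (s == 1) || (s == -1) ->
  step s d1 -> step s d2 -> step s d3 -> step s d4 -> d1 + d2 + d3 + d4 = 0 ->
  ((`|d1| == 3)%R + (`|d2| == 3)%R + (`|d3| == 3)%R + (`|d4| == 3)%R)%N = 1%N.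
Proof.
by rewrite /step => /orP[]/eqP-> /orP[]/eqP-> /orP[]/eqP-> /orP[]/eqP-> /orP[]/eqP->.
Qed.

(** [a - b] is a multiple of 4 and the two steps differ by 0 or 4, so the order of the two functions
    is never strictly reversed along an edge and the minimum follows one of them. *)
Lemma step_min s a a' b b' : (s == 1) || (s == -1) -> step s (a' - a) -> step s (b' - b) ->
  ((a - b) %% 4)%Z = 0 -> step s (Num.min a' b' - Num.min a b).
Proof. by rewrite /step; lia. Qed.

Lemma step_max s a a' b b' : (s == 1) || (s == -1) -> step s (a' - a) -> step s (b' - b) ->
  ((a - b) %% 4)%Z = 0 -> step s (Num.max a' b' - Num.max a b).
Proof. by rewrite /step; lia. Qed.

Lemma local_height_min h h' c : local_height h c -> local_height h' c ->
  (forall v, corner c v -> ((h v - h' v) %% 4)%Z = 0) ->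
  local_height (fun v => Num.min (h v) (h' v)) c.
Proof.
move=> /and4P[e1 e2 e3 e4] /and4P[d1 d2 d3 d4] hm.
have ss : (sgn c == 1) || (sgn c == -1) by case: (sgn_cases c) => ->.
by apply/and4P; split; apply: step_min => //; apply: hm; rewrite /corner /= ?eqxx ?orbT.
Qed.

Lemma local_height_max h h' c : local_height h c -> local_height h' c ->
  (forall v, corner c v -> ((h v - h' v) %% 4)%Z = 0) ->
  local_height (fun v => Num.max (h v) (h' v)) c.
Proof.
move=> /and4P[e1 e2 e3 e4] /and4P[d1 d2 d3 d4] hm.
have ss : (sgn c == 1) || (sgn c == -1) by case: (sgn_cases c) => ->.
by apply/and4P; split; apply: step_max => //; apply: hm; rewrite /corner /= ?eqxx ?orbT.
Qed.

(* Two adjacent cells share the edge between these two vertices. *)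
Definition jump (h : vertex -> int) (c c' : cell) : bool :=
  `|h (Num.max c.1 c'.1, Num.max c.2 c'.2) -
    h (Num.min c.1 c'.1 + 1, Num.min c.2 c'.2 + 1)| == 3.

Lemma jumpC h c c' : jump h c c' = jump h c' c.
Proof. by rewrite /jump maxC [Num.max c.2 _]maxC minC [Num.min c.2 _]minC. Qed.

Section JumpE.
Variables (h : vertex -> int) (i j : int).

Lemma jump_E : jump h (i, j) (i + 1, j) = (`|h (i + 1, j + 1) - h (i + 1, j)| == 3).
Proof.
rewrite /jump /= distrC (_ : Num.max i (i + 1) = i + 1); last by lia.
by rewrite (_ : Num.min i (i + 1) = i) ?maxxx ?minxx//; lia.
Qed.

Lemma jump_W : jump h (i, j) (i - 1, j) = (`|h (i, j) - h (i, j + 1)| == 3).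
Proof.
rewrite /jump /= (_ : Num.max i (i - 1) = i); last by lia.
by rewrite (_ : Num.min i (i - 1) = i - 1) ?maxxx ?minxx ?subrK//; lia.
Qed.

Lemma jump_N : jump h (i, j) (i, j + 1) = (`|h (i, j + 1) - h (i + 1, j + 1)| == 3).
Proof.
rewrite /jump /= (_ : Num.max j (j + 1) = j + 1); last by lia.
by rewrite (_ : Num.min j (j + 1) = j) ?maxxx ?minxx//; lia.
Qed.

Lemma jump_S : jump h (i, j) (i, j - 1) = (`|h (i + 1, j) - h (i, j)| == 3).
Proof.
rewrite /jump /= distrC (_ : Num.max j (j - 1) = j); last by lia.
by rewrite (_ : Num.min j (j - 1) = j - 1) ?maxxx ?minxx ?subrK//; lia.
Qed.

End JumpE.

(** The steps around [c] sum to 0, so exactly one is a jump by 3: a local height function matches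
    each cell with one neighbour, which may lie outside the region. *)
Lemma local_height_jump h c : local_height h c ->
  exists2 c', adj c c' && jump h c c' & forall e, adj c e -> jump h c e -> e = c'.
Proof.
case: c => i j; rewrite /local_height /= => hl.
have : ((jump h (i, j) (i + 1, j))%R + (jump h (i, j) (i - 1, j))%R +
    (jump h (i, j) (i, j + 1))%R + (jump h (i, j) (i, j - 1))%R)%N = 1%N.
  rewrite jump_E jump_W jump_N jump_S; case/and4P: hl => d1 d2 d3 d4.
  have ss : (sgn (i, j) == 1) || (sgn (i, j) == -1) by case: (sgn_cases (i, j)) => ->.
  apply: step_count ss d2 d4 d3 d1 _.
  by move: (h _) (h _) (h _) (h _) => x1 x2 x3 x4; ring.
have fin d : adj (i, j) d -> (forall c', adj (i, j) c' -> jump h (i, j) c' = (c' == d)) ->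
  exists2 c', adj (i, j) c' && jump h (i, j) c' & forall e, adj (i, j) e -> jump h (i, j) e -> e = c'.
  move=> ad H; exists d; first by rewrite ad H ?eqxx.
  by move=> e ae; rewrite H// => /eqP.
case e1: (jump _ _ (i + 1, j)); case e2: (jump _ _ (i - 1, j));
case e3: (jump _ _ (i, j + 1)); case e4: (jump _ _ (i, j - 1)) => // _.
- apply: (fin (i + 1, j)); first by rewrite /adj /= eqxx ?orbT.
  by move=> c' /or4P[]/eqP->; rewrite ?e1 ?e2 ?e3 ?e4 !xpair_eqE /=; lia.
- apply: (fin (i - 1, j)); first by rewrite /adj /= eqxx ?orbT.
  by move=> c' /or4P[]/eqP->; rewrite ?e1 ?e2 ?e3 ?e4 !xpair_eqE /=; lia.
- apply: (fin (i, j + 1)); first by rewrite /adj /= eqxx ?orbT.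
  by move=> c' /or4P[]/eqP->; rewrite ?e1 ?e2 ?e3 ?e4 !xpair_eqE /=; lia.
- apply: (fin (i, j - 1)); first by rewrite /adj /= eqxx ?orbT.
  by move=> c' /or4P[]/eqP->; rewrite ?e1 ?e2 ?e3 ?e4 !xpair_eqE /=; lia.
Qed.

Lemma heightlike_jump S T h c c' : is_tiling S T -> heightlike S T h -> c \in S ->
  c' \notin S -> adj c c' -> jump h c c' = false.
Proof.
move=> tT hh cS c'S; have nc : cross T c c' = false.
  by apply: contraNF c'S => /(cross_mem tT)[].
have [e1 e2 e3 e4] := hh c cS; case: c cS nc e1 e2 e3 e4 => i j cS nc e1 e2 e3 e4.
case/or4P => /eqP e; rewrite e /= in nc *.
- rewrite jump_E; move: e4; rewrite /diffN /= addrK nc mulr1; clear.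
  by have [->|->] := sgn_cases (i + 1, j); do ![move: (h _) => ?]; lia.
- rewrite jump_W; move: e3; rewrite /diffN /= crossC nc mulr1; clear.
  by have [->|->] := sgn_cases (i, j); do ![move: (h _) => ?]; lia.
- rewrite jump_N; move: e2; rewrite /diffE /= addrK crossC nc; clear.
  by have [->|->] := sgn_cases (i, j + 1); do ![move: (h _) => ?]; lia.
- rewrite jump_S; move: e1; rewrite /diffE /= nc; clear.
  by have [->|->] := sgn_cases (i, j); do ![move: (h _) => ?]; lia.
Qed.

Lemma common_cell (v v' : vertex) : `|v.1 - v'.1| <= 1 -> `|v.2 - v'.2| <= 1 ->
  let c := (Num.min v.1 v'.1, Num.min v.2 v'.2) in corner c v /\ corner c v'.
Proof. by case: v v' => [a b] [a' b']; rewrite /corner /=; lia. Qed.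

Lemma cheb_le0 x z : cheb x z <= 0 -> z = x.
Proof.
case: x z => [x1 x2] [z1 z2]; rewrite /cheb /= => h.
by have [-> ->] : z1 = x1 /\ z2 = x2; first by split; lia.
Qed.

Lemma retract (a b k : int) : 0 <= k -> `|b - a| <= k + 1 ->
  exists2 t, `|b - t| <= 1 & `|t - a| <= k.
Proof.
move=> k0 h; have [ba|ba] := leP b (a - 1); first by exists (b + 1); lia.
have [ab|ab] := leP (a + 1) b; first by exists (b - 1); lia.
by exists b; lia.
Qed.

(** Moving each coordinate by exactly 1 gives a diagonal step, which keeps the parity of the
    coordinate sum. *)
Lemma retract_odd (a b k : int) : 1 <= k -> `|b - a| <= k + 1 ->
  exists2 t, (t == b - 1) || (t == b + 1) & `|t - a| <= k.
Proof.
by move=> k0 h; have [ba|ba] := leP b a; [exists (b + 1)|exists (b - 1)]; lia.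
Qed.

Lemma cheb_le x v (k : int) :
  (cheb x v <= k) = (`|v.1 - x.1| <= k) && (`|v.2 - x.2| <= k).
Proof. by rewrite /cheb ge_max. Qed.

Section Square.
Variables (K : realType) (S : {fset cell}) (h1 h2 W : vertex -> int) (x : vertex) (M : nat).
Hypotheses (rS : region K S) (M_gt0 : (0 < M)%N).
Hypotheses (hl1 : forall c, c \in S -> local_height h1 c).
Hypotheses (hl2 : forall c, c \in S -> local_height h2 c).
Hypotheses (hW : forall c v, c \in S -> corner c v -> h1 v - h2 v = 4 * W v).
Hypotheses (W0 : forall k v, k \notin S -> corner k v -> W v = 0).
Hypothesis (Wx : W x = M%:Z).

Lemma cell_of_W c v : corner c v -> 0 < W v -> c \in S.
Proof. by move=> cv Wv; apply: contraTT Wv => cS; rewrite (W0 cS cv). Qed.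

(** Each height varies by at most 3 on a cell, so [4 * (W v - W v') <= 6]. *)
Lemma W_lip c v v' : c \in S -> corner c v -> corner c v' -> W v <= W v' + 1.
Proof.
move=> cS cv cv'; have := local_height_dist (hl1 cS) cv cv'.
have := local_height_dist (hl2 cS) cv cv'; have := hW cS cv; have := hW cS cv'.
by move: (h1 _) (h1 _) (h2 _) (h2 _) (W _) (W _); case: (_ %| _)%Z => /=; lia.
Qed.

(** Induct outwards from [x]. Where [W] is positive all surrounding cells lie in [S], so the next
    step, between two corners of a cell, stays in the region and costs at most 1. *)
Lemma ball_W (k : nat) z : (k <= M)%N -> cheb x z <= k%:Z ->
  (exists2 c, c \in S & corner c z) /\ M%:Z - k%:Z <= W z.
Proof.
elim: k z => [|k IH] z kM zk.
  rewrite (cheb_le0 zk).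
  rewrite Wx; split; last by lia.
  have xx : corner x x by rewrite /corner !eqxx.
  by exists x => //; apply: (cell_of_W xx); rewrite Wx; lia.
have [zk1 zk2] : `|z.1 - x.1| <= k%:Z + 1 /\ `|z.2 - x.2| <= k%:Z + 1.
  by move: zk; rewrite cheb_le => /andP[]; lia.
have [t1 zt1 tx1] := retract (isT : 0 <= k%:Z) zk1.
have [t2 zt2 tx2] := retract (isT : 0 <= k%:Z) zk2.
have [_ Wz'] : (exists2 c, c \in S & corner c (t1, t2)) /\ M%:Z - k%:Z <= W (t1, t2).
  by apply: IH; [lia|rewrite cheb_le tx1 tx2].
have [cz cz'] := common_cell (v := z) (v' := (t1, t2)) zt1 zt2.
set c := (_, _) in cz cz'.
have cS : c \in S by apply: (cell_of_W cz'); lia.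
by split; [exists c|have := W_lip cS cz' cz; lia].
Qed.

Lemma in_square_region c : in_square x M c -> c \in S.
Proof.
move=> cQ; have [v [cv v1 v2]] : exists v, [/\ corner c v, `|v.1 - x.1| <= M%:Z - 1 & `|v.2 - x.2| <= M%:Z - 1].
  move: cQ; case: (c) => i j; rewrite /in_square /= /corner /= => cQ.
  have [u hu ux] : exists2 u, (u == i) || (u == i + 1) & `|u - x.1| <= M%:Z - 1.
    by have [h|h] := ltP i x.1; [exists (i + 1)|exists i]; lia.
  have [w hw wx] : exists2 w, (w == j) || (w == j + 1) & `|w - x.2| <= M%:Z - 1.
    by have [h|h] := ltP j x.2; [exists (j + 1)|exists j]; lia.
  by exists (u, w); rewrite /= hu hw.
apply: (cell_of_W cv).
have [_] : (exists2 c, c \in S & corner c v) /\ M%:Z - (M.-1)%:Z <= W v.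
  by apply: ball_W; [lia|rewrite cheb_le; lia].
by lia.
Qed.

(** All steps but the one next to [x] can be made diagonal, at cost 2; that one may run along an
    edge, which accounts for the extra 1 at odd parity. *)
Lemma ball_height h (k : nat) z : (forall c, c \in S -> local_height h c) -> (k <= M)%N ->
  cheb x z <= k%:Z ->
  `|h z - h x| <= 2 * k%:Z + (~~ (2 %| (z.1 + z.2) - (x.1 + x.2)))%Z%:Z.
Proof.
move=> hl; elim: k z => [|k IH] z kM zk.
  rewrite (cheb_le0 zk).
  by rewrite subrr normr0.
have Wk z' : cheb x z' <= k%:Z -> 0 < W z'.
  move=> /(ball_W (ltnW kM))[_]; lia.
have [k0|k0] := posnP k.
  subst k; have [||cz cx] := @common_cell z x.
  - by move: zk; rewrite /cheb; lia.
  - by move: zk; rewrite /cheb; lia.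
  set c := (_, _) in cz cx.
  have cS : c \in S by apply: (cell_of_W cx); rewrite Wx; lia.
  exact: local_height_dist (hl _ cS) cz cx.
have [zk1 zk2] : `|z.1 - x.1| <= k%:Z + 1 /\ `|z.2 - x.2| <= k%:Z + 1.
  by move: zk; rewrite cheb_le => /andP[]; lia.
have k1 : 1 <= k%:Z by lia.
have [t1 zt1 tx1] := retract_odd k1 zk1; have [t2 zt2 tx2] := retract_odd k1 zk2.
pose z' := (t1, t2).
have z'k : cheb x z' <= k%:Z by rewrite cheb_le tx1 tx2.
have [||cz cz'] := @common_cell z z'; [by rewrite /z' /=; lia..|].
set c := (_, _) in cz cz'.
have cS : c \in S by apply: (cell_of_W cz'); exact: Wk.
have := local_height_dist (hl _ cS) cz cz'; have := IH z' (ltnW kM) z'k.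
have -> : (2 %| (z.1 + z.2) - (z'.1 + z'.2))%Z.
  by rewrite /z' /=; lia.
have -> : (2 %| (z'.1 + z'.2) - (x.1 + x.2))%Z = (2 %| (z.1 + z.2) - (x.1 + x.2))%Z.
  by rewrite /z' /=; lia.
by move: (h _) (h _) (h _); case: (_ %| _)%Z => /=; lia.
Qed.

(** The level is halfway between [h1 x] and [h2 x = h1 x - 4M]. The blocks are aligned with the
    lower-left corner of the square, so its border consists of block borders. *)
Definition flat_height : vertex -> int :=
  block_height (x.1 - M%:Z, x.2 - M%:Z) (h1 x - 2 * M%:Z).

(** The median where [h2 v <= h1 v]; elsewhere [h2 v]. *)
Definition median_height (v : vertex) : int :=
  Num.max (Num.min (flat_height v) (h1 v)) (h2 v).

(** It suffices to look at [x]: there [block_height] adds 0 or 2 according to the parity of [M],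
    which cancels [2 * M] modulo 4. *)
Lemma flat_height_mod c v : c \in S -> corner c v -> ((flat_height v - h1 v) %% 4)%Z = 0.
Proof.
move=> cS cv.
have xx : corner x x by rewrite /corner !eqxx.
have xS : x \in S by apply: (cell_of_W xx); rewrite Wx; lia.
rewrite (region_vertex_const rS (f := fun v => ((flat_height v - h1 v) %% 4)%Z) _ cS xS cv xx).
  rewrite /flat_height /block_height /=.
  by rewrite !subKr; case e: (2 %| _)%Z; move: (h1 x) e => w; clear=> /=; lia.
move=> d w w' dS; apply: local_height_mod; [exact: block_height_local|exact: hl1].
Qed.

Lemma median_height_local c : c \in S -> local_height median_height c.
Proof.
move=> cS; apply: local_height_max; [|exact: hl2|].
  apply: local_height_min; [exact: block_height_local|exact: hl1|].
  by move=> v; exact: flat_height_mod.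
move=> v cv; have := flat_height_mod cS cv; have := hW cS cv.
by move: (h1 v) (h2 v) (W v) (flat_height v); lia.
Qed.

Lemma flat_height_border v : cheb x v = M%:Z ->
  `|flat_height v - (h1 x - 2 * M%:Z)| <= 1.
Proof.
rewrite /cheb /flat_height /block_height /= => hv.
have : (2 %| v.1 - (x.1 - M%:Z))%Z || (2 %| v.2 - (x.2 - M%:Z))%Z by lia.
clear hv.
by case: (sgn_cases (x.1 - M%:Z, x.2 - M%:Z)) => ->; case: (2 %| _)%Z; case: (2 %| _)%Z => //= _;
  move: (h1 x) => w; clear; lia.
Qed.

(** [ball_height] gives [h2 v <= flat_height v <= h1 v] up to an error of 2, and the congruences
    modulo 4 remove the error. *)
Lemma median_height_border v : cheb x v = M%:Z -> median_height v = flat_height v.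
Proof.
move=> hv; have := flat_height_border hv.
have vM : cheb x v <= M%:Z by rewrite hv.
have := ball_height hl1 (leqnn M) vM; have := ball_height hl2 (leqnn M) vM.
have [[c cS cv] _] := ball_W (leqnn M) vM.
have := flat_height_mod cS cv; have := hW cS cv.
have xx : corner x x by rewrite /corner !eqxx.
have xS : x \in S by apply: (cell_of_W xx); rewrite Wx; lia.
have := hW xS xx; rewrite Wx /median_height.
move: (h1 x) (h1 v) (h2 x) (h2 v) (W v) (flat_height v).
by case: (_ %| _)%Z => /=; lia.
Qed.

Lemma median_height_outer v k : k \notin S -> corner k v ->
  (exists2 c, c \in S & corner c v) -> median_height v = h1 v.
Proof.
move=> kS kv [c cS cv]; have := hW cS cv; rewrite (W0 kS kv) /median_height.
by move: (h1 v) (h2 v) (flat_height v); lia.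
Qed.

Lemma adj_corners c c' : adj c c' ->
  let v := (Num.max c.1 c'.1, Num.max c.2 c'.2) in
  let v' := (Num.min c.1 c'.1 + 1, Num.min c.2 c'.2 + 1) in
  [/\ corner c v, corner c' v, corner c v' & corner c' v'].
Proof. by rewrite adjE /corner /=; case: c c' => [i j] [i' j'] /=; split; lia. Qed.

Hypothesis h1_outer : forall c c', c \in S -> c' \notin S -> adj c c' -> jump h1 c c' = false.

(** The partner lies across the jump of [median_height]. On the border of the square heights differ
    by at most 2, so no jump crosses it; on the boundary of the region the function equals [h1],
    whose jumps stay inside. *)
Lemma square_matching : exists m : cell -> cell,
  forall c, c \in S -> ~~ in_square x M c ->
    [/\ m c \in S, ~~ in_square x M (m c), adj c (m c) & m (m c) = c].
Proof.
pose good c d := c \in S -> [/\ adj c d, jump median_height c d &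
   forall e, adj c e -> jump median_height c e -> e = d].
have [m hm] : {m & forall c, good c (m c)}.
  apply: choice => c; have [cS|cS] := boolP (c \in S); last by exists c; rewrite /good (negPf cS).
  have [d /andP[ad jd] hd] := local_height_jump (median_height_local cS).
  by exists d.
exists m => c cS cQ; have [ad jd _] := hm c cS.
have [v1 v2 v3 v4] := adj_corners ad; set v := (_, _) in v1 v2; set v' := (_, _) in v3 v4.
have mS : m c \in S.
  apply: contraT => mS; move: jd; rewrite /jump -/v -/v' (median_height_outer mS v2); last by exists c.
  rewrite (median_height_outer mS v4); last by exists c.
  by have := h1_outer cS mS ad; rewrite /jump -/v -/v' => ->.
have mQ : ~~ in_square x M (m c).
  apply/negP => mQ; have [hv hv'] : cheb x v = M%:Z /\ cheb x v' = M%:Z.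
    move: ad cQ mQ; rewrite adjE /in_square /cheb /v /v' /=.
    by move: (c.1) (c.2) ((m c).1) ((m c).2) (x.1) (x.2) => c1 c2 d1 d2 x1 x2; split; lia.
  move: jd; rewrite /jump -/v -/v' !median_height_border//.
  have := flat_height_border hv; have := flat_height_border hv'.
  by move: (flat_height _) (flat_height _) (h1 x); lia.
split=> //; have [_ _ h] := hm _ mS.
have ad' : adj (m c) c by rewrite adj_sym.
have jd' : jump median_height (m c) c by rewrite jumpC.
by rewrite -(h c ad' jd').
Qed.

End Square.

(** * Forcing sets and orderings of the white cells *)

Local Open Scope fset_scope.

(** Take a minimal nonempty stable set: its image is stable too, hence equal to it, so [f] permutes
    it. *)
Lemma finite_cycle (U : finType) (f : U -> U) (u : U) : exists C : {set U},
  [/\ C != finset.set0, {in C, forall v, f v \in C}, {in C &, injective f} &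
     forall v, v \in C -> exists2 w, w \in C & f w = v].
Proof.
pose P (C : {set U}) := (C != finset.set0) && (f @: C \subset C)%SET.
have PT : P (finset.setTfor U) by rewrite /P finset.subsetT andbT -card_gt0 finset.cardsT; apply/card_gt0P; exists u.
have [C /minsetP[/andP[C0 fC] Cmin] _] := minset_exists PT.
have fCE : (f @: C = C)%SET.
  apply: Cmin => //; rewrite /P imsetS// andbT.
  have /finset.set0Pn[v vC] := C0; apply/finset.set0Pn; exists (f v); exact: imset_f.
exists C; split => //.
- by move=> v vC; rewrite -fCE imset_f.
- by apply/imset_injP; rewrite fCE.
- by move=> v; rewrite -{1}fCE => /imsetP[w wC ->]; exists w.
Qed.

Section Matching.
Variables (S : {fset cell}) (mu : cell -> cell).
Hypothesis mu_adj : forall w, w \in S -> white w -> adj w (mu w) && (mu w \in S).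
Hypothesis mu_inj : forall w w', w \in S -> w' \in S -> white w -> white w' ->
  mu w = mu w' -> w = w'.
Hypothesis mu_surj : forall b, b \in S -> ~~ white b ->
  exists2 w, w \in S & white w /\ mu w = b.

Definition matching_tiling : {fset {fset cell}} :=
  [fset [fset w; mu w] | w in [fset c in S | white c]].

Lemma matching_tilingP d :
  reflect (exists2 w, (w \in S) && white w & d = [fset w; mu w]) (d \in matching_tiling).
Proof.
rewrite /matching_tiling; apply: (iffP (imfsetP _ _ _ _)) => -[w].
  by rewrite !inE /= => h ->; exists w.
by move=> h ->; exists w => //; rewrite !inE /=.
Qed.

Lemma matching_is_tiling : is_tiling S matching_tiling.
Proof.
split=> [d /matching_tilingP[w /andP[wS ww] ->]|c cS].
  have /andP[ad mS] := mu_adj wS ww; split; first exact: adj_domino.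
  by apply/fsubsetP => e; rewrite in_fset2 => /orP[]/eqP->.
have [w [wS ww cw]] : exists w, [/\ w \in S, white w & c \in [fset w; mu w]].
  have [wc|bc] := boolP (white c); first by exists c; rewrite in_fset2 eqxx.
  have [w wS [ww <-]] := mu_surj cS bc; exists w.
  by rewrite in_fset2 eqxx orbT.
exists [fset w; mu w]; split.
  by split=> //; apply/matching_tilingP; exists w; rewrite ?wS.
move=> _ [/matching_tilingP[w' /andP[w'S ww'] ->]]; rewrite in_fset2 => cw'.
suff -> : w = w' by [].
have /andP[/white_adj bw _] := mu_adj wS ww; have /andP[/white_adj bw' _] := mu_adj w'S ww'.
move: cw cw'; rewrite in_fset2 => /orP[]/eqP-> /orP[]/eqP // e.
- by move: bw'; rewrite -e ww ww'.
- by move: bw; rewrite e ww ww'.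
- exact: mu_inj.
Qed.

End Matching.

Lemma tiling_mate (S : {fset cell}) (T : {fset {fset cell}}) : is_tiling S T ->
  exists pi : cell -> cell, forall c, c \in S ->
    adj c (pi c) /\ forall e, cross T c e = (e == pi c).
Proof.
move=> tT.
pose good c d := c \in S -> adj c d /\ forall e, cross T c e = (e == d).
have [m hm] : {m & forall c, good c (m c)}.
  apply: choice => c; have [cS|cS] := boolP (c \in S); last by exists c; rewrite /good (negPf cS).
  by have [d ad hd] := tiling_partner tT cS; exists d.
by exists m.
Qed.

Definition nbrs (S : {fset cell}) (W : seq cell) : {fset cell} :=
  [fset b in S | has (fun w => adj w b) W].

Section Forcing.
Variables (S : {fset cell}) (T F : {fset {fset cell}}) (pi : cell -> cell).
Hypotheses (tT : is_tiling S T) (fF : forcing_set S T F).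
Hypothesis piP : forall c, c \in S -> adj c (pi c) /\ forall e, cross T c e = (e == pi c).

Lemma pi_mem c : c \in S -> pi c \in S.
Proof.
move=> cS; have [_ h] := piP cS; have : cross T c (pi c) by rewrite h.
by move/(cross_mem tT) => [].
Qed.

Lemma pi_involutive c : c \in S -> pi (pi c) = c.
Proof.
move=> cS; have [_ h] := piP cS; have [_ h'] := piP (pi_mem cS).
by have := h' c; rewrite crossC h eqxx => /esym/eqP <-.
Qed.

(* Otherwise each w in U is adjacent to the mate of another cell f w of U;
   rematching the periodic points of f gives a second tiling containing F. *)
Lemma forcing_acyclic (U : {fset cell}) : U != fset0 ->
  (forall w, w \in U -> [/\ w \in S, white w & [fset w; pi w] \notin F]) ->
  exists2 w, w \in U & forall w', w' \in U -> w' != w -> ~~ adj w (pi w').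
Proof.
move=> /fset0Pn[u uU] hU; apply: contrapT => nex.
pose succ (w v : U) : Prop := (val v != val w) && adj (val w) (pi (val v)).
have nx (w : U) : exists v : U, succ w v.
  apply: contrapT => h; apply: nex; exists (val w); first exact: valP.
  move=> w' w'U ww'; apply/negP => ad; apply: h.
  by exists [` w'U]; rewrite /succ /= ww' ad.
have [f hf] : {f & forall w : U, succ w (f w)} by exact: choice nx.
have [C [C0 fC finj fsurj]] := finite_cycle f [` uU].
pose inC (c : cell) := [exists w : U, (w \in C) && (val w == c)].
have inCP c : reflect (exists2 w : U, w \in C & val w = c) (inC c).
  apply: (iffP existsP) => -[w]; first by move=> /andP[wC /eqP]; exists w.
  by move=> wC wc; exists w; rewrite wC wc eqxx.
pose mu c := if insub c is Some w then (if (w : U) \in C then pi (val (f w)) else pi c) else pi c.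
have muC (w : U) : w \in C -> mu (val w) = pi (val (f w)) by move=> wC; rewrite /mu valK wC.
have muN c : ~~ inC c -> mu c = pi c.
  move=> h; rewrite /mu; case: insubP => // w wU wc; case: ifP => // wC.
  by case/inCP: h; exists w.
have valS (w : U) : val w \in S by have [] := hU _ (valP w).
have pi_inj c c' : c \in S -> c' \in S -> pi c = pi c' -> c = c'.
  by move=> cS c'S e; rewrite -(pi_involutive cS) e pi_involutive.
have tT' : is_tiling S (matching_tiling S mu).
  apply: matching_is_tiling.
  - move=> w wS ww; have [/inCP[v vC <-]|h] := boolP (inC w).
      by rewrite muC//; have /andP[_ ->] := hf v; exact: pi_mem.
    by rewrite muN// pi_mem// andbT; have [] := piP wS.
  - move=> w w' wS w'S _ _; have [/inCP[v vC <-]|h] := boolP (inC w);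
      have [/inCP[v' v'C <-]|h'] := boolP (inC w').
    + by rewrite !muC// => /pi_inj e; rewrite (finj v v')//; apply/val_inj/e.
    + rewrite muC// muN// => /pi_inj e; case/inCP: h'; exists (f v); first exact: fC.
      exact: e.
    + rewrite muC// muN// => /pi_inj e; case/inCP: h; exists (f v'); first exact: fC.
      exact/esym/e.
    + by rewrite !muN//; exact: pi_inj.
  - move=> b bS bb; have [ad _] := piP bS.
    have wpi : white (pi b) by rewrite (white_adj ad).
    have [/inCP[v vC vb]|h] := boolP (inC (pi b)).
      have [w wC fw] := fsurj v vC; exists (val w); first exact: valS.
      have [_ ww _] := hU _ (valP w); split=> //.
      by rewrite muC// fw vb pi_involutive.
    by exists (pi b); rewrite ?pi_mem// muN// pi_involutive.
(* Only white cells of [U] are rematched, and their dominoes in [T] are not in [F]. *)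
have FT' : F `<=` matching_tiling S mu.
  apply/fsubsetP => d dF; have [/fsubsetP FT _] := fF.
  have dT := FT d dF; have [dd /fsubsetP dS] := proj1 tT d dT.
  have [c [cd wc]] : exists c, c \in d /\ white c.
    case: (dd) => i [j [] dE]; have [w|w] := boolP (white (i, j)).
    - by exists (i, j); rewrite dE in_fset2 eqxx.
    - exists ((i + 1)%R, j); rewrite dE in_fset2 eqxx orbT; split=> //.
      by rewrite (white_adj (c := (i, j))) ?w// adjE /=; lia.
    - by exists (i, j); rewrite dE in_fset2 eqxx.
    - exists (i, (j + 1)%R); rewrite dE in_fset2 eqxx orbT; split=> //.
      by rewrite (white_adj (c := (i, j))) ?w// adjE /=; lia.
  have cS := dS c cd; have [c' ac' dE] := domino_partner dd cd.
  have [_ h] := piP cS; have c'E : c' = pi c by apply/eqP; rewrite -h /cross -dE.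
  apply/matching_tilingP; exists c; first by rewrite cS.
  rewrite muN -?c'E//; apply/inCP => -[w wC wE].
  have [_ _] := hU _ (valP w); rewrite wE -c'E -dE.
  by rewrite dF.
have TE := proj2 fF _ tT' FT'.
have /finset.set0Pn[w wC] := C0.
have [_ ww _] := hU _ (valP w).
have : [fset val w; mu (val w)] \in T.
  by rewrite -TE; apply/matching_tilingP; exists (val w); rewrite ?valS.
have [_ h] := piP (valS w); rewrite -/(cross T _ _) h muC// => /eqP e.
have e' := pi_inj _ _ (valS _) (valS _) e.
by have /andP[] := hf w; rewrite e' eqxx.
Qed.

(** Peel off the cells given by [forcing_acyclic]: no cell is adjacent to the mate of a later
    one. *)
Lemma forcing_order_free (U : {fset cell}) :
  (forall w, w \in U -> [/\ w \in S, white w & [fset w; pi w] \notin F]) ->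
  exists s, [/\ uniq s, s =i U & pairwise (fun w w' => ~~ adj w (pi w')) s].
Proof.
have [n] := ubnP #|` U|; elim: n U => // n IH U Un hU.
have [U0|U0] := eqVneq U fset0.
  by exists [::]; split=> // c; rewrite U0.
have [w wU hw] := forcing_acyclic U0 hU.
have Ucard := cardfsD1 w U; rewrite wU in Ucard.
have [||s [us sU ps]] := IH (U `\ w).
- by move: Un; rewrite Ucard; lia.
- by move=> c; rewrite in_fsetD1 => /andP[_]; exact: hU.
exists (w :: s); split => /=.
- by rewrite sU in_fsetD1 eqxx.
- by move=> c; rewrite in_cons sU in_fsetD1; case: eqVneq => // ->; rewrite wU.
- rewrite ps andbT; apply/allP => w'; rewrite sU in_fsetD1 => /andP[ww' w'U].
  exact: hw.
Qed.

(** White cells covered by [F] come last. A neighbour of an initial segment is then the mate of a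
    member of the segment or of a cell covered by [F], and the latter number at most [#|F|]. *)
Lemma forcing_order : exists s : seq cell,
  [/\ uniq s, forall c, (c \in s) = (c \in S) && white c &
     forall n, (#|` nbrs S (take n s)| <= size (take n s) + #|` F|)%N].
Proof.
pose U := [fset c in S | white c && ([fset c; pi c] \notin F)].
pose V := [fset c in S | white c && ([fset c; pi c] \in F)].
have [|s [us sU ps]] := @forcing_order_free U.
  by move=> w; rewrite !inE /= => /and3P[].
exists (s ++ V); split.
- rewrite cat_uniq us fset_uniq andbT /=; apply/hasPn => c; rewrite sU !inE /=.
  by move=> /and3P[-> -> ->].
- move=> c; rewrite mem_cat sU !inE /=; case: (_ \in S) => //=; case: white => //=.
  by case: (_ \in F).
move=> n; set W := take n _.
have sub : nbrs S W `<=` [fset c in map pi W] `|` [fset pi c | c in V].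
  apply/fsubsetP => b; rewrite !inE /= => /andP[bS /hasP[w wW ad]].
  have bE := pi_involutive bS; have wS' := pi_mem bS; set w' := pi b in bE wS'.
  have wsV : w \in s ++ V by exact: mem_take wW.
  have [wS ww] : w \in S /\ white w.
    move: wsV; rewrite mem_cat sU !inE /=.
    by case/orP => /and3P[-> ->].
  have [ad' _] := piP bS; have ww' : white w'.
    by rewrite (white_adj ad') (white_adj ad) ww.
  have [w'V|w'V] := boolP (w' \in V).
    by apply/orP; right; apply/imfsetP; exists w'.
  have w's : w' \in s.
    rewrite sU; move: w'V; rewrite !inE /= wS' ww' /=.
    by case: (_ \in F).
  apply/orP; left; rewrite -bE; apply: map_f; rewrite /W take_cat.
  case: ltnP => ns; last by rewrite mem_cat w's.
  apply: contraT => w'W; have w'd : w' \in drop n s.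
    by move: w's; rewrite -{1}(cat_take_drop n s) mem_cat (negPf w'W).
  have ws : w \in take n s by move: wW; rewrite /W take_cat ns.
  move: ps; rewrite -{1}(cat_take_drop n s) pairwise_cat => /and3P[/allrelP h _ _].
  by have := h _ _ ws w'd; rewrite bE ad.
apply: leq_trans (fsubset_leq_card sub) _; apply: leq_trans (leq_card_fsetU _ _) _.
apply: leq_add.
  rewrite card_fseq; apply: leq_trans (size_undup _) _.
  by rewrite size_map.
apply: leq_trans (leq_imfset_card _ _ _) _ => /=.
have inj : {in V &, injective (fun c => [fset c; pi c])}.
  move=> c c'; rewrite !inE /= => /and3P[cS wc _] /and3P[c'S wc' _] e.
  have : c \in [fset c'; pi c'] by rewrite -e in_fset2 eqxx.
  rewrite in_fset2 => /orP[/eqP//|/eqP e'].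
  by have [ad _] := piP c'S; move: (white_adj ad); rewrite -e' wc wc'.
rewrite -(card_in_imfset imfset_key inj); apply: fsubset_leq_card.
by apply/fsubsetP => d /imfsetP[c /=]; rewrite !inE /= => /and3P[_ _ h] ->.
Qed.

End Forcing.

Local Close Scope fset_scope.

(** * Strips of the square *)

Lemma boundary_index (P : nat -> bool) (r r' : nat) : P r -> ~~ P r' ->
  exists k, [/\ (k < maxn r r')%N & (P k && ~~ P k.+1) || (~~ P k && P k.+1)].
Proof.
move=> Pr Pr'; apply: contrapT => h.
have const n : (n <= maxn r r')%N -> P n = P 0%N.
  elim: n => // n IH nr; rewrite -IH; last exact: ltnW.
  by apply/eqP; apply: contraT => e; case: h; exists n; split=> //; case: (P n) (P n.+1) e => -[].
by move: Pr'; rewrite const ?leq_maxr// -(const r) ?leq_maxl// Pr.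
Qed.

Section Strips.
Variables (S : {fset cell}) (W : seq cell) (mu : cell -> cell) (M L : nat).
Variables (w b : nat -> nat -> cell).
Hypothesis W_uniq : uniq W.
Hypothesis W_white : forall c, c \in W -> (c \in S) && white c.
Hypothesis mu_adj : forall c, c \in S -> white c -> adj c (mu c) && (mu c \in S).
Hypothesis mu_inj : forall c c', c \in S -> c' \in S -> white c -> white c' ->
  mu c = mu c' -> c = c'.
Hypothesis w_mem : forall j r, (j < M)%N -> (r < L)%N ->
  [/\ w j r \in S, white (w j r) & mu (w j r) = b j r].
Hypothesis w_inj : forall j r j' r', (j < M)%N -> (r < L)%N -> (j' < M)%N -> (r' < L)%N ->
  w j r = w j' r' -> j = j'.
Hypothesis w_adj : forall j r, (j < M)%N -> (r.+1 < L)%N ->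
  adj (w j r) (b j r.+1) && adj (w j r.+1) (b j r).
Hypothesis mixed : forall j, (j < M)%N -> exists r r',
  [/\ (r < L)%N, (r' < L)%N, w j r \in W & w j r' \notin W].

Lemma strips_excess : (size W + M <= #|` nbrs S W|)%N.
Proof.
have nb j : (j < M)%N -> exists r, [/\ (r < L)%N, w j r \notin W & b j r \in nbrs S W].
  (* Between some positions k and k + 1 membership in [W] changes, and the cell in [W] is adjacent
     to the mate of the other. *)
  move=> jM; have [r [r' [rL r'L wr wr']]] := mixed jM.
  have [k [kr]] := @boundary_index (fun r => w j r \in W) _ _ wr wr'.
  have kL : (k.+1 < L)%N by apply: leq_ltn_trans kr _; rewrite gtn_max rL.
  have /andP[a1 a2] := w_adj jM kL.
  have bS i : (i < L)%N -> b j i \in S.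
    by move=> iL; have [iS iw <-] := w_mem jM iL; have /andP[] := mu_adj iS iw.
  case/orP => /andP[h1 h2]; [exists k.+1|exists k]; split=> //.
  - by rewrite !inE /= bS//; apply/hasP; exists (w j k).
  - exact: ltnW.
  - by rewrite !inE /= bS ?(ltnW kL)//; apply/hasP; exists (w j k.+1).
pose good (j : 'I_M) r := [/\ (r < L)%N, w j r \notin W & b j r \in nbrs S W].
have [r hr] : {r & forall j, good j (r j)} by apply: choice => j; exact: nb.
pose E := [seq w j (r j) | j : 'I_M].
have Euniq : uniq E.
  rewrite map_inj_uniq ?enum_uniq// => j j' e; apply: val_inj => /=.
  have [h1 _ _] := hr j; have [h2 _ _] := hr j'.
  exact: (w_inj (ltn_ord j) h1 (ltn_ord j') h2 e).
have Esub c : c \in E -> [/\ c \in S, white c, c \notin W & mu c \in nbrs S W].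
  move=> /mapP[j _ ->]; have [h1 h2 h3] := hr j.
  by have [h4 h5 h6] := w_mem (ltn_ord j) h1; rewrite h6.
have WE_uniq : uniq (W ++ E).
  rewrite cat_uniq W_uniq Euniq andbT /=; apply/hasPn => c /Esub[_ _ h _]; exact: h.
have WES c : c \in W ++ E -> (c \in S) && white c.
  by rewrite mem_cat => /orP[/W_white|/Esub[-> ->]].
have sizeE : size E = M by rewrite size_map size_enum_ord.
rewrite -{1}sizeE -size_cat -(size_map mu).
have mu_uniq : uniq (map mu (W ++ E)).
  rewrite map_inj_in_uniq// => c c' /WES/andP[cS cw] /WES/andP[c'S c'w].
  exact: mu_inj.
apply: (uniq_leq_size mu_uniq) => d /mapP[c + ->].
rewrite mem_cat => /orP[cW|/Esub[] //].
have /andP[cS cw] := W_white cW; have /andP[ad mS] := mu_adj cS cw.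
by rewrite !inE /= mS; apply/hasP; exists c.
Qed.

End Strips.

Definition cell_at (q : cell) (tr : bool) (a r : nat) : cell :=
  if tr then (q.1 + r%:Z, q.2 + a%:Z) else (q.1 + a%:Z, q.2 + r%:Z).

(* Strip j consists of the lines 2j and 2j + 1 (columns, or rows if [tr]) of the
   square with lower-left cell q; it has one white cell at each position r along it. *)
Definition strip_white (q : cell) (tr : bool) (j r : nat) : cell :=
  cell_at q tr (j.*2 + (white q == odd r)) r.

Definition strip_black (q : cell) (tr : bool) (j r : nat) : cell :=
  cell_at q tr (j.*2 + (white q != odd r)) r.

Lemma cell_at_tr q tr a r : cell_at q tr a r = cell_at q (~~ tr) r a.
Proof. by case: tr. Qed.

Lemma white_cell_at q tr a r : white (cell_at q tr a r) = white q (+) odd (a + r).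
Proof.
have -> : white (cell_at q tr a r) = (2 %| (q.1 + q.2) + (a + r)%N%:Z)%Z.
  by case: tr; rewrite /white /=; congr (_ %| _)%Z; lia.
by rewrite dvd2zD /white; case: (2 %| q.1 + q.2)%Z; case e : (odd (a + r)) => /=; lia.
Qed.

Lemma strip_whiteP q tr j r : white (strip_white q tr j r).
Proof.
rewrite white_cell_at !oddD odd_double oddb /=.
by case: (white q); case: (odd r).
Qed.

(* The same white cell seen in the strip of the other direction. *)
Lemma strip_white_tr q tr j r :
  strip_white q tr j r = strip_white q (~~ tr) r./2 (j.*2 + (white q == odd r)).
Proof.
rewrite /strip_white cell_at_tr oddD odd_double oddb /=.
rewrite (_ : (white q == (white q == odd r)) = odd r); last by case: white; case: odd.
by rewrite [(r./2.*2 + _)%N]addnC odd_double_half.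
Qed.

Definition flip (x y : int) : int := if (2 %| x - y)%Z then x + 1 else x - 1.

(** Dominoes laid across the strips of direction [tr], each spanning the width 2. *)
Definition block_mate (q : cell) (tr : bool) (c : cell) : cell :=
  if tr then (c.1, flip c.2 q.2) else (flip c.1 q.1, c.2).

Lemma flipK x y : flip (flip x y) y = x.
Proof.
rewrite /flip; case e: (2 %| x - y)%Z.
  by rewrite (_ : (2 %| x + 1 - y)%Z = false); lia.
by rewrite (_ : (2 %| x - 1 - y)%Z); lia.
Qed.

Lemma block_mateK q tr c : block_mate q tr (block_mate q tr c) = c.
Proof. by case: tr; case: c => i j; rewrite /block_mate /= flipK. Qed.

Lemma block_mate_adj q tr c : adj c (block_mate q tr c).
Proof. by rewrite adjE /block_mate /flip; case: tr => /=; case: ifP; lia. Qed.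

Lemma block_mate_square x (M : int) tr c : in_square x M c ->
  in_square x M (block_mate (x.1 - M, x.2 - M) tr c).
Proof.
rewrite /in_square /block_mate /flip; case: c x => [i j] [x1 x2] /=.
by case: tr => /=; case: ifP => e; move: e; lia.
Qed.

Lemma block_mate_strip q tr j r :
  block_mate q tr (strip_white q tr j r) = strip_black q tr j r.
Proof.
rewrite /block_mate /strip_white /strip_black /cell_at /flip.
by case: tr => /=; rewrite addrAC subrr add0r; case: (white q == odd r);
  case: ifP => /= h; congr pair; move: h; lia.
Qed.

Lemma mem_takeS (A : eqType) (s : seq A) (n : nat) (c c0 : A) :
  c \in take n.+1 s -> (c \in take n s) || (c == nth c0 s n).
Proof.
have [ns|ns] := ltnP n (size s); last by rewrite !take_oversize ?leqW// => ->.
by rewrite (take_nth c0 ns) mem_rcons in_cons orbC.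
Qed.

Lemma cell_at_square x (M : nat) tr a r : (a < M.*2)%N -> (r < M.*2)%N ->
  in_square x M (cell_at (x.1 - M%:Z, x.2 - M%:Z) tr a r).
Proof. by rewrite /in_square; case: tr => /=; lia. Qed.

Lemma cell_at_inj q tr a r a' r' : cell_at q tr a r = cell_at q tr a' r' ->
  a = a' /\ r = r'.
Proof. by case: tr => -[]; lia. Qed.

Lemma strip_adj q tr j r : adj (strip_white q tr j r) (strip_black q tr j r.+1) &&
  adj (strip_white q tr j r.+1) (strip_black q tr j r).
Proof.
rewrite /strip_white /strip_black /= !adjE; apply/andP.
by case: (white q); case: (odd r); case: tr => /=; split; lia.
Qed.

Lemma square_bound (S : {fset cell}) (x : vertex) (M f : nat) (s : seq cell) (m : cell -> cell) :
  (0 < M)%N -> uniq s -> (forall c, (c \in s) = (c \in S) && white c) ->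
  (forall n, (#|` nbrs S (take n s)| <= size (take n s) + f)%N) ->
  (forall c, in_square x M%:Z c -> c \in S) ->
  (forall c, c \in S -> ~~ in_square x M%:Z c ->
    [/\ m c \in S, ~~ in_square x M%:Z (m c), adj c (m c) & m (m c) = c]) ->
  (M <= f)%N.
Proof.
move=> M0 us sE hf QS hm.
pose q : cell := (x.1 - M%:Z, x.2 - M%:Z).
have wQ tr j r : (j < M)%N -> (r < M.*2)%N -> in_square x M%:Z (strip_white q tr j r).
  by move=> jM rM; apply: cell_at_square => //; case: (_ == _); lia.
pose full tr j n := all (fun r => strip_white q tr j r \in take n s) (iota 0 M.*2).
pose P n := has (fun tr => has (fun j => full tr j n) (iota 0 M)) [:: true; false].
have exP : exists n, P n.
  exists (size s); apply/orP; left; apply/hasP; exists 0%N; first by rewrite mem_iota.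
  apply/allP => r; rewrite mem_iota /= => rM.
  have := sE (strip_white q true 0 r); rewrite strip_whiteP andbT take_size => ->.
  by apply/QS/wQ.
case: (ex_minnP exP) => -[|n] Pn nmin.
  move: Pn => /hasP[tr _ /hasP[j _ /allP /(_ 0%N)]].
  by rewrite mem_iota /= double_gt0 M0 take0 => /(_ isT).
have notfull tr j : (j < M)%N -> exists2 r, (r < M.*2)%N & strip_white q tr j r \notin take n s.
  move=> jM; suff /allPn[r] : ~~ full tr j n by rewrite mem_iota; exists r.
  apply/negP => h; suff /nmin : P n by rewrite ltnn.
  apply/hasP; exists tr; first by case: tr {h}.
  by apply/hasP; exists j; rewrite ?mem_iota.
have /hasP[tr _ /hasP[i]] := Pn; rewrite mem_iota /= => iM /allP tri.
pose d := ~~ tr.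
have strip_mem j : (j < M)%N -> exists2 r, (r < M.*2)%N & strip_white q d j r \in take n s.
  move=> jM.
  (* Strip j crosses the exhausted strip i in a 2 x 2 block with two white cells. Only the cell of
     index [n] in [s] can be missing from [take n s], so one of the two is present. *)
  have h (e : bool) : (strip_white q d j (i.*2 + e) \in take n s) ||
      (strip_white q d j (i.*2 + e) == nth q s n).
    apply: mem_takeS; rewrite strip_white_tr /d negbK.
    rewrite (_ : (i.*2 + e)./2 = i); last by case: e; lia.
    by apply: tri; rewrite mem_iota /=; case: (_ == _); lia.
  case/orP: (h false) => [h0|/eqP h0]; first by exists (i.*2 + false)%N => //; lia.
  case/orP: (h true) => [h1|/eqP h1]; first by exists (i.*2 + true)%N => //; lia.
  by move: h0; rewrite -h1 => /cell_at_inj[_]; lia.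
(* Since neither part crosses the border of the square, the combined map is injective. *)
pose mu c := if in_square x M%:Z c then block_mate q d c else m c.
have muQ c : in_square x M%:Z c -> mu c = block_mate q d c by rewrite /mu => ->.
have muN c : ~~ in_square x M%:Z c -> mu c = m c by rewrite /mu => /negPf ->.
have WS c : c \in take n s -> (c \in S) && white c by move=> /mem_take; rewrite sE.
rewrite -(leq_add2l (size (take n s))); apply: leq_trans (hf n).
apply: (@strips_excess S (take n s) mu M M.*2 (strip_white q d) (strip_black q d)) => //.
- exact: take_uniq.
- move=> c cS _; have [cQ|cQ] := boolP (in_square x M%:Z c).
    by rewrite muQ// block_mate_adj; apply/QS/block_mate_square.
  by rewrite muN//; have [-> _ -> _] := hm c cS cQ.
- move=> c c' cS c'S _ _; have [cQ|cQ] := boolP (in_square x M%:Z c);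
    have [c'Q|c'Q] := boolP (in_square x M%:Z c').
  + by rewrite !muQ// => e; rewrite -(block_mateK q d c) e block_mateK.
  + rewrite muQ// muN// => e; have [_ + _ _] := hm c' c'S c'Q.
    by rewrite -e block_mate_square.
  + rewrite muN// muQ// => e; have [_ + _ _] := hm c cS cQ.
    by rewrite e block_mate_square.
  + rewrite !muN// => e; have [_ _ _ <-] := hm c cS cQ; have [_ _ _ <-] := hm c' c'S c'Q.
    by rewrite e.
- move=> j r jM rM; split; [exact/QS/wQ|exact: strip_whiteP|].
  by rewrite muQ ?wQ// block_mate_strip.
- move=> j r j' r' _ _ _ _ /cell_at_inj[+ _].
  by case: (_ == _); case: (_ == _); lia.
- by move=> j r _ _; exact: strip_adj.
- move=> j jM; have [r rM rW] := strip_mem j jM; have [r' r'M r'W] := notfull d j jM.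
  by exists r, r'.
Qed.

(** * From the square bound to the forcing number *)

Lemma height_gap (K : realType) (S : {fset cell}) (T1 T2 T F : {fset {fset cell}})
    (p x : vertex) (c0 k0 c : cell) :
  region K S -> is_tiling S T1 -> is_tiling S T2 -> is_tiling S T -> forcing_set S T F ->
  c0 \in S -> corner c0 p -> k0 \notin S -> corner k0 p -> c \in S -> corner c x ->
  height T1 p x - height T2 p x <= 4 * (#|` F|%fset)%:Z.
Proof.
move=> rS t1 t2 tT fF c0S c0p k0S k0p cS cx.
have [hh1 hp1] := height_spec p rS t1; have [hh2 hp2] := height_spec p rS t2.
have [|W [hW W0]] := height_difference rS t1 t2 hh1 hh2 c0S c0p k0S k0p.
  by rewrite hp1 hp2.
rewrite (hW c x)//; suff : W x <= (#|` F|%fset)%:Z by lia.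
have [|Wpos] := leP (W x) 0; first by lia.
have WM : W x = (`|W x|%N)%:Z by lia.
have M0 : (0 < `|W x|%N)%N by lia.
have hl1 d : d \in S -> local_height (height T1 p) d by exact: heightlike_local t1 hh1.
have hl2 d : d \in S -> local_height (height T2 p) d by exact: heightlike_local t2 hh2.
have outer d d' : d \in S -> d' \notin S -> adj d d' -> jump (height T1 p) d d' = false.
  exact: heightlike_jump t1 hh1.
have [m hm] := square_matching rS M0 hl1 hl2 hW W0 WM outer.
have [pi piP] := tiling_mate tT.
have [s [us sE hs]] := forcing_order tT fF piP.
have QS d : in_square x (`|W x|%N)%:Z d -> d \in S.
  exact: in_square_region M0 hl1 hl2 hW W0 WM _.
have := square_bound M0 us sE hs QS hm; lia.
Qed.

Lemma lattice_point_corner (K : realType) (S : {fset cell}) (x : vertex) :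
  carrier K S (embed K x) -> exists2 c, c \in S & corner c x.
Proof.
case=> c cS /closed_squareE[/= h1 h2]; exists c => //.
have int_end (i j : int) : (i%:~R : K) <= j%:~R <= i%:~R + 1 -> (j == i) || (j == i + 1).
  by rewrite -[X in _ <= _ + X]/(1%:~R) -intrD !ler_int; lia.
by rewrite /corner (int_end _ _ _ h1) (int_end _ _ _ h2).
Qed.

Lemma closed_carrier (K : realType) (S : {fset cell}) : closed (carrier K S).
Proof.
apply: closed_bigcup; first exact: finite_fset.
move=> c _.
have -> : closed_square K c = (fst @^-1` `[c.1%:~R, (c.1 + 1)%:~R]%classic) `&`
    (snd @^-1` `[c.2%:~R, (c.2 + 1)%:~R]%classic) by [].
apply: closedI.
  by apply: preimage_closed; [move=> y _; exact: cvg_fst|exact: itv_closed].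
by apply: preimage_closed; [move=> y _; exact: cvg_snd|exact: itv_closed].
Qed.

(** The carrier is closed, so it contains [p]; were all four cells around [p] in [S], the unit ball
    around [p] would lie in it. *)
Lemma boundary_point_corners (K : realType) (S : {fset cell}) (p : vertex) :
  boundary_points K S p ->
  (exists2 c, c \in S & corner c p) /\ (exists2 k, k \notin S & corner k p).
Proof.
case=> clp nip; split.
  apply: (@lattice_point_corner K).
  by rewrite (iffLR (closure_id _) (@closed_carrier K S)).
apply: contrapT => h; apply: nip; apply/nbhs_ballP; exists 1 => //= -[y1 y2] [/= b1 b2].
have side (i : int) (y : K) : ball (i%:~R : K) 1 y ->
    exists2 j : int, (i == j) || (i == j + 1) & j%:~R <= y <= j%:~R + 1.
  rewrite /ball /= ltr_norml => /andP[d1 d2].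
  have [iy|yi] := leP i%:~R y; first by exists i; rewrite ?eqxx//; lra.
  exists (i - 1); first by rewrite subrK eqxx orbT.
  by rewrite intrB; lra.
have [j1 e1 f1] := side _ _ b1; have [j2 e2 f2] := side _ _ b2.
have cS : (j1, j2) \in S.
  by apply: contraT => nS; case: h; exists (j1, j2); rewrite // /corner e1 e2.
by exists (j1, j2) => //; apply/closed_squareE.
Qed.

Lemma maximum_mem (A : set int) (B : int) : A !=set0 -> ubound A B ->
  A (maximum 0 A) /\ ubound A (maximum 0 A).
Proof.
move=> [a Aa] AB.
have ex : exists n : nat, `[< exists2 z, A z & B - z = n%:Z >].
  exists `|B - a|%N; apply/asboolP; exists a => //.
  by have := AB a Aa; lia.
case: (ex_minnP ex) => n /asboolP[z Az zn] nmin.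
have uz : ubound A z.
  move=> y Ay; have yB := AB y Ay.
  have /nmin : `[< exists2 t, A t & B - t = (`|B - y|%N)%:Z >].
    by apply/asboolP; exists y => //; lia.
  by lia.
by rewrite /maximum; case: xgetP => [m _ []|/(_ z)[]].
Qed.

Lemma minimum_mem (A : set int) (B : int) : A !=set0 -> lbound A B ->
  A (minimum 0 A) /\ lbound A (minimum 0 A).
Proof.
move=> [a Aa] AB.
have ex : exists n : nat, `[< exists2 z, A z & z - B = n%:Z >].
  exists `|a - B|%N; apply/asboolP; exists a => //.
  by have := AB a Aa; lia.
case: (ex_minnP ex) => n /asboolP[z Az zn] nmin.
have uz : lbound A z.
  move=> y Ay; have yB := AB y Ay.
  have /nmin : `[< exists2 t, A t & t - B = (`|y - B|%N)%:Z >].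
    by apply/asboolP; exists y => //; lia.
  by lia.
by rewrite /minimum; case: xgetP => [m _ []|/(_ z)[]].
Qed.

Lemma nat_minimum_mem (A : set nat) : A !=set0 -> A (minimum 0%N A).
Proof.
move=> [a Aa]; have ex : exists n : nat, `[< A n >] by exists a; apply/asboolP.
case: (ex_minnP ex) => n /asboolP An nmin.
rewrite /minimum; case: xgetP => [m _ []//|/(_ n)[]]; split=> // y Ay.
by rewrite leEnat; apply: nmin; apply/asboolP.
Qed.

Lemma forcing_set_self (S : {fset cell}) (T : {fset {fset cell}}) :
  is_tiling S T -> forcing_set S T T.
Proof.
move=> tT; split; first exact: fsubset_refl.
move=> T' tT' /fsubsetP TT'; apply/fsetP => d; apply/idP/idP; last exact: TT'.
move=> dT'; have [dd /fsubsetP dS] := proj1 tT' d dT'.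
have [c cd] : exists c, c \in d.
  by case: dd => i [j [->|->]]; exists (i, j); rewrite in_fset2 eqxx.
have [e [[eT ce] _]] := proj2 tT c (dS c cd).
by rewrite (tiling_unique tT' dT' (TT' e eT) cd ce).
Qed.

Lemma forcing_number_attained (S : {fset cell}) : (exists T, is_tiling S T) ->
  exists T F, [/\ is_tiling S T, forcing_set S T F & forcing_number S = #|` F|%fset].
Proof.
move=> [T0 t0].
have [T tT fT] : [set forcing_number_of S T | T in is_tiling S] (forcing_number S).
  by apply: nat_minimum_mem; exists (forcing_number_of S T0), T0.
have [F fF cF] : [set #|` F|%fset | F in forcing_set S T] (forcing_number_of S T).
  by apply: nat_minimum_mem; exists #|` T|%fset, T => //; exact: forcing_set_self.
by exists T, F; rewrite -fT -cF.
Qed.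

Theorem theorem1p1 (K : realType) (S : {fset cell}) (p : vertex) :
  region K S ->
  (exists T, is_tiling S T) ->
  boundary_points K S p ->
  (1 / 4 : rat) *
    (maximum 0 [set hmax S p x - hmin S p x | x in lattice_points K S])%:~R
  <= (forcing_number S)%:R.
Proof.
move=> rS exT bp; have [T [F [tT fF ->]]] := forcing_number_attained exT.
have [[c0 c0S c0p] [k0 k0S k0p]] := boundary_point_corners bp.
set X := maximum _ _; suff : X <= 4 * (#|` F|%fset)%:Z.
  by rewrite -(ler_int rat) intrM => h; rewrite -[leRHS]/((#|` F|%fset)%:Z%:~R); lra.
(* Without a greatest element [maximum] is 0 and the bound is immediate; otherwise its value comes
   from some lattice point [x]. *)
rewrite /X /maximum; case: xgetP => [_ _ [[x /lattice_point_corner[c cS cx] <-] _]|_]; last first.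
  by [].
have gap T1 T2 : is_tiling S T1 -> is_tiling S T2 ->
    height T1 p x - height T2 p x <= 4 * (#|` F|%fset)%:Z.
  by move=> t1 t2; exact: height_gap rS t1 t2 tT fF c0S c0p k0S k0p cS cx.
pose A := [set height T' p x | T' in is_tiling S].
have A0 : A !=set0 by exists (height T p x), T.
(* The gap bound against the fixed tiling [T] bounds all heights at [x], so [hmax] and [hmin] are
   attained. *)
have [[T1 t1 <-] _] : A (hmax S p x) /\ ubound A (hmax S p x).
  apply: (@maximum_mem A (height T p x + 4 * (#|` F|%fset)%:Z)) => // _ [T' t' <-].
  by have := gap T' T t' tT; lia.
have [[T2 t2 <-] _] : A (hmin S p x) /\ lbound A (hmin S p x).
  apply: (@minimum_mem A (height T p x - 4 * (#|` F|%fset)%:Z)) => // _ [T' t' <-].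
  by have := gap T T' tT t'; lia.
exact: gap.
Qed.
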